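(* Let $T$ be an infinite, locally finite tree rooted at $o$ and having no leaves except possibly $o$. Let $\{J_v : v\neq o\}$ satisfy $0<J_{\min}\le J_v\le J_{\max}<\infty$, let $\beta>0$ and $\theta_v=\tanh(\beta J_v)$. Assume spherical symmetry: $\theta_v=\theta_{|v|}$ depends only on $|v|$, and for each $i\ge1$ every vertex at level $i-1$ has the same number $d_i$ of children. Then there are multiple Gibbs states for the Ising model at inverse temperature $\beta$ with interaction strengths $J_v$ if and only if $$\sum_{n\ge1}\prod_{i=1}^n(d_i\theta_i)^{-2}<\infty .$$ In particular, suppose that $\theta_v=\theta\in(0,1)$ is constant, that $T$ is spherically symmetric, and that for some $\alpha\in\mathbb R$ the level cardinalities satisfy $|T_n|\asymp\theta^{-n}n^\alpha$ (that is, $c_1\theta^{-n}n^{\alpha}\le |T_n|\le c_2\theta^{-n}n^\alpha$ for all $n\ge1$, for some constants $0<c_1\le c_2<\infty$). Then there is a unique Gibbs state for this Ising model if and only if $\alpha\le 1/2$.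
   Context: $|v|$ is the distance from $o$ to $v$, $T_n=\{v:|v|=n\}$ is level $n$, and $v\to w$ means $v$ is the parent of $w$ (the neighbor of $w$ closer to $o$). The interaction $J_w$ is attached to the edge from $w$ to its parent. A Gibbs state (Gibbs measure) at inverse temperature $\beta$ is a probability measure on $\{\pm1\}^{V(T)}$ such that for every finite $\Lambda\subset V(T)$ the conditional law of $\eta|_\Lambda$ given $\eta|_{\Lambda^c}$ is proportional to $\exp\big(\beta\sum J_w\eta(v)\eta(w)\big)$, the sum being over edges $v\to w$ with at least one endpoint in $\Lambda$. *)

(* Defs.v *)
From mathcomp Require Import all_boot all_order all_algebra finmap.
From mathcomp Require Import all_classical all_reals all_analysis.

Set Implicit Arguments.
Unset Strict Implicit.
Unset Printing Implicit Defensive.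

Import Order.TTheory GRing.Theory Num.Theory.
Import numFieldNormedType.Exports.

Local Open Scope classical_set_scope.
Local Open Scope ring_scope.

Definition tanh (R : realType) (x : R) : R :=
  (expR x - expR (- x)) / (expR x + expR (- x)).

Section RootedTree.
Variables (V : choiceType) (e : rel V) (o : V).

(* A tree: a simple graph that is connected and has no cycle. A cycle is a
   duplicate-free cyclic sequence of at least three vertices, since [:: x; y]
   is a [ucycle] as soon as x and y are adjacent. *)
Definition is_tree : Prop :=
  [/\ symmetric e, irreflexive e,
      forall x y : V, exists2 p : seq V, path e x p & last x p = y
    & forall c : seq V, (2 < size c)%N -> ~ ucycle e c].

Definition neighbors (v : V) : set V := [set w | e v w].

Definition locally_finite : Prop := forall v : V, finite_set (neighbors v).

Definition is_leaf (v : V) : Prop := exists w : V, neighbors v = [set w].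

Definition walk_of_length (x y : V) (n : nat) : Prop :=
  exists p : seq V, [/\ path e x p, last x p = y & size p = n].

(* Graph distance; the default value 0 is only used when no walk joins x to y,
   which does not happen in a connected graph. *)
Definition dist (x y : V) : nat :=
  xget 0%N [set n | walk_of_length x y n /\
                    forall m, walk_of_length x y m -> (n <= m)%N].

Definition level (n : nat) : set V := [set v | dist o v = n].

Definition is_parent (v w : V) : Prop := e v w /\ (dist o v < dist o w)%N.

Definition children (v : V) : set V := [set w | is_parent v w].

(* [fset_set A] has the elements of A when A is finite, as is [children v] in
   a locally finite graph, and is empty otherwise. *)
Definition spherically_symmetric_with (d : nat -> nat) : Prop :=
  forall i : nat, (0 < i)%N ->
    forall v : V, level i.-1 v -> #|` fset_set (children v)| = d i.

Definition spherically_symmetric : Prop :=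
  exists d : nat -> nat, spherically_symmetric_with d.

End RootedTree.

(* Spin configurations in {+1, -1}^V are encoded as functions V -> bool, with
   true standing for +1 and false for -1. *)
Definition spin (R : realType) (b : bool) : R := if b then 1 else -1.

Section Configurations.
Variable V : choiceType.

Definition coordinate_events (S : set V) : set (set (V -> bool)) :=
  [set A | exists2 v, S v & exists b : bool, A = [set eta | eta v = b]].

Definition coordinate_sigma (S : set V) : set (set (V -> bool)) :=
  <<s coordinate_events S >>.

(* The space V -> bool with its product sigma-algebra. *)
Definition config := g_sigma_algebraType (coordinate_events [set: V]).

Definition glue (L : {fset V}) (sigma : {ffun L -> bool}) (eta : V -> bool) :
    V -> bool :=
  fun v => if insub v is Some u then sigma u else eta v.

End Configurations.

(* [f] is a version of the conditional probability of [A] given the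
   sub-sigma-algebra [F]. *)
Definition is_cond_prob (d : measure_display) (T : measurableType d)
    (R : realType) (mu : probability T R) (F : set (set T)) (A : set T)
    (f : T -> R) : Prop :=
  [/\ forall B : set R, measurable B -> F (f @^-1` B),
      mu.-integrable [set: T] (EFin \o f)
    & forall B : set T, F B ->
        mu (A `&` B) = (\int[mu]_(x in B) (f x)%:E)%E].

Section Ising.
Variables (R : realType) (V : choiceType) (e : rel V) (o : V).
Variables (J : V -> R) (beta : R).

(* Pairs (v, w) with v the parent of w; J w sits on that edge. *)
Definition touching_edges (L : {fset V}) : set (V * V) :=
  [set vw | is_parent e o vw.1 vw.2 /\ (vw.1 \in L \/ vw.2 \in L)].

(* The set of edges touching L is finite when the tree is locally finite. *)
Definition boltzmann_weight (L : {fset V}) (eta : V -> bool) : R :=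
  expR (beta * \sum_(vw \in touching_edges L)
                 (J vw.2 * spin R (eta vw.1) * spin R (eta vw.2))).

Definition gibbs_kernel (L : {fset V}) (sigma : {ffun L -> bool})
    (eta : V -> bool) : R :=
  boltzmann_weight L (glue sigma eta) /
  \sum_(tau : {ffun L -> bool}) boltzmann_weight L (glue tau eta).

Definition gibbs_state (mu : probability (config V) R) : Prop :=
  forall (L : {fset V}) (sigma : {ffun L -> bool}),
    is_cond_prob mu (coordinate_sigma (~` [set` L]))
      [set eta : config V | forall u : L, eta (val u) = sigma u]
      (gibbs_kernel sigma).

(* Measures are compared on measurable sets only: the value of a [probability]
   on a non-measurable set is arbitrary. *)
Definition multiple_gibbs_states : Prop :=
  exists mu nu : probability (config V) R,
    [/\ gibbs_state mu, gibbs_state nu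
      & exists2 A : set (config V), measurable A & mu A <> nu A].

Definition unique_gibbs_state : Prop :=
  exists2 mu : probability (config V) R, gibbs_state mu &
    forall nu : probability (config V) R, gibbs_state nu ->
      forall A : set (config V), measurable A -> nu A = mu A.

End Ising.

(* Main.v *)
From HB Require Import structures.
Require Import Defs.
From mathcomp Require Import all_boot all_order all_algebra finmap.
From mathcomp Require Import all_classical all_reals all_analysis.
From mathcomp Require Import zify ring lra.
Import Order.TTheory GRing.Theory Num.Theory.
Import numFieldNormedType.Exports.
Local Open Scope classical_set_scope.
Local Open Scope ring_scope.

Set Implicit Arguments.
Unset Strict Implicit.
Unset Printing Implicit Defensive.

(** Write theta_v = tanh (beta J_v), so that an edge contributes to the Gibbs
   weight a factor proportional to 1 + theta_w s_v s_w.  For a field m on the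
   vertices with values in [-1, 1], consider the Markov chain on the tree in
   which a child w of a vertex of spin s takes the spin s' with probability
   proportional to (1 + theta_w s s') (1 + s' m_w).  If
     prod_w (1 + theta_w s m_w) = c (1 + s m_v)   (w over the children of v)
   at every v in a finite set L, the chain satisfies the DLR equation at L.
   Hence m = 0 always gives a Gibbs state, and a nonzero spherical solution of
   the recursion gives another one.  Conversely, taking m equal to the boundary
   spins outside a ball and solving the recursion inside identifies the
   finite-volume Gibbs measure with such a chain, so the Gibbs state is unique
   as soon as the extremal fields mag, which start from 1 at distance n below a
   given level, tend to 0.

   In the spherical case the recursion reads
     m_{i-1} = tanh (d_i artanh (theta_i m_i)),
   and F_i = 1 / m_i^2 - c satisfies F_{i-1} <= (d_i theta_i)^-2 (F_i + 1) for
   c = 1, and F_{i-1} >= (d_i theta_i)^-2 (F_i + (1 - theta_i^2) / 7) for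
   c = 1/7.  So 1 / m_0^2 is comparable to the partial sums of the series of the
   theorem. *)

(** * A tree rooted at o *)

Section Tree.
Variables (V : choiceType) (e : rel V) (o : V).
Hypothesis Htree : is_tree e.

Let e_sym : symmetric e. Proof. by case: Htree. Qed.
Let e_conn x y : exists2 p : seq V, path e x p & last x p = y.
Proof. by case: Htree. Qed.

(** If the paths leave x through different vertices a and b, going along the first and back along
    the second gives a walk from a to b that avoids x and closes up to a cycle through x. *)
Lemma tree_simple_path_unique (x : V) (p q : seq V) :
  path e x p -> uniq (x :: p) -> path e x q -> uniq (x :: q) ->
  last x p = last x q -> p = q.
Proof.
elim: p x q => [|a p IH] x [|b q] //=.
- move=> _ _ _ /andP[+ _] lq; by rewrite lq mem_last.
- move=> _ /andP[+ _] _ _ lq; by rewrite -lq mem_last.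
move=> /andP[exa pa] /andP[xap uap] /andP[exb qb] /andP[xbq ubq] lpq.
have [ab|neq_ab] := eqVneq a b.
  by subst b; congr cons; apply: (IH a) => //=.
exfalso.
pose r := p ++ rev (belast b q).
have pr : path e a r.
  rewrite cat_path pa /= lpq rev_path.
  by under eq_path => u w do rewrite e_sym.
have lr : last a r = b.
  rewrite /r last_cat; case: (q) lpq => [|c q'] /=; first by [].
  by rewrite rev_cons last_rcons.
have xr : x \notin a :: r.
  rewrite in_cons negb_or /r mem_cat mem_rev negb_or.
  move: xap; rewrite in_cons negb_or => /andP[-> ->] /=.
  by apply: contra xbq; exact: mem_belast.
(* Removing repetitions keeps the ends a and b; as these differ, the cycle through x, a and b has at
   least three vertices. *)
case/shortenP: pr lr => r' pr' ur' sr' lr'.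
case: Htree => _ _ _ /(_ [:: x, a & r']) acyc; apply: acyc.
  by case: r' lr' {pr' ur' sr'} => //= aeqb; rewrite aeqb eqxx in neq_ab.
rewrite /ucycle /cycle rcons_path /= exa pr' lr' e_sym exb /=.
move: ur'; rewrite /= => ->; rewrite andbT.
move: xr; rewrite !in_cons !negb_or => /andP[-> xr] /=.
by apply: contra xr; exact: sr'.
Qed.

Lemma dist_spec x y : walk_of_length e x y (dist e x y) /\
  forall m, walk_of_length e x y m -> (dist e x y <= m)%N.
Proof.
rewrite /dist; set A := [set n | _]; suff: A (xget 0%N A) by [].
apply: xgetPex.
have [p pp lp] := e_conn x y.
have ex : exists n, `[< walk_of_length e x y n >].
  by exists (size p); apply/asboolP; exists p.
exists (ex_minn ex); case: ex_minnP => m /asboolP wm mmin; split => // k wk.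
by apply: mmin; apply/asboolP.
Qed.

Lemma dist_le_path x p : path e x p -> (dist e x (last x p) <= size p)%N.
Proof. by move=> pp; apply: (dist_spec x _).2; exists p. Qed.

Lemma dist_self x : dist e x x = 0%N.
Proof. by apply/eqP; rewrite -leqn0 (@dist_le_path x [::]). Qed.

Lemma dist_eq0 v : dist e o v = 0%N -> v = o.
Proof.
by move=> d0; have [[p [_ + sz]] _] := dist_spec o v; rewrite d0 in sz; case: p sz.
Qed.

Lemma dist_edge v w : e v w -> (dist e o w <= (dist e o v).+1)%N.
Proof.
move=> evw; have [[p [pp lp sp]] _] := dist_spec o v.
have := @dist_le_path o (rcons p w); rewrite rcons_path pp lp evw last_rcons.
by rewrite size_rcons sp; apply.
Qed.

Lemma parent_dist v w : is_parent e o v w -> dist e o w = (dist e o v).+1.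
Proof. by move=> [/dist_edge h1 h2]; apply/eqP; rewrite eqn_leq h1 h2. Qed.

(** A shortest walk repeats no vertex, and each proper prefix is a shorter walk, which bounds the
    distance of its end. *)
Lemma geodesic v : exists p, [/\ path e o p, last o p = v, uniq (o :: p) &
   forall x, x \in o :: p -> x != v -> (dist e o x < dist e o v)%N].
Proof.
have [[p [pp lp sp]] dmin] := dist_spec o v; exists p.
have up : uniq (o :: p).
  (* By minimality the shortened path is at least as long as [p], and it uses only vertices of [p];
     hence [p] itself has no repetition. *)
  case/shortenP: (pp) lp => p' pp' up' sp' lp'.
  have szp : (size p <= size p')%N by rewrite sp; apply: dmin; exists p'.
  have /andP[opp' upp'] := up'.
  have [pe eqp] := @uniq_min_size _ p' p upp' sp' szp.
  by rewrite /= -eqp opp'; apply: (leq_size_uniq upp' sp').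
split=> // x xp xv; have := xp; case/splitPl: xp pp lp sp up => p1 p2 lp1.
rewrite cat_path last_cat lp1 => /andP[pp1 pp2] lp2 sp up _.
rewrite -sp size_cat -lp1; apply: (leq_ltn_trans (dist_le_path pp1)).
case: p2 lp2 {sp up pp2} => /= [xv'|a p2 _]; last by rewrite addnS ltnS leq_addr.
by rewrite xv' eqxx in xv.
Qed.

(** A geodesic to a parent of w avoids w, which is farther from o, so appending w keeps it simple.
    Both parents are then the last but one vertex of the unique simple path from o to w. *)
Lemma parent_unique v v' w :
  is_parent e o v w -> is_parent e o v' w -> v = v'.
Proof.
suff gen u : is_parent e o u w ->
    exists p, [/\ path e o (rcons p w), uniq (o :: rcons p w) & last o p = u].
  move=> /gen[p [pp up lp]] /gen[q [pq uq lq]].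
  have : rcons p w = rcons q w.
    by apply: tree_simple_path_unique pp up pq uq _; rewrite !last_rcons.
  by move=> /rcons_inj[pq']; rewrite -lp -lq pq'.
move=> [euw duw]; have [p [pp lp up dp]] := geodesic u; exists p; split=> //.
  by rewrite rcons_path pp lp.
rewrite -rcons_cons rcons_uniq up andbT; apply/negP => wp.
have wu : w != u by apply: contraL duw => /eqP ->; rewrite ltnn.
by have := dp _ wp wu; rewrite ltnNge (ltnW duw).
Qed.

Lemma parent_exists w : w <> o -> exists v, is_parent e o v w.
Proof.
move=> wo; have [p [pp lp up dp]] := geodesic w.
case/lastP: p pp lp up dp => [_ /= /esym //|p a].
rewrite rcons_path last_rcons => /andP[pp ea] aw up dp; rewrite {}aw in ea up dp.
exists (last o p); split => //; apply: dp.
  by rewrite -rcons_cons mem_rcons in_cons mem_last orbT.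
apply: contraTneq up => lw; rewrite -rcons_cons rcons_uniq negb_and negbK.
by rewrite -lw mem_last.
Qed.

Lemma parent_not_root v w : is_parent e o v w -> w <> o.
Proof. by move=> [_ +] wo; rewrite wo dist_self ltn0. Qed.

End Tree.

(** * Parents, levels and an enumeration of the vertices *)

Definition parent (V : choiceType) (e : rel V) (o w : V) : V :=
  xget o [set v | is_parent e o v w].

Definition fchildren (V : choiceType) (e : rel V) (o v : V) : {fset V} :=
  fset_set (children e o v).

(** A breadth-first list: each list is a prefix of the next one, and parents precede their
    children. *)
Fixpoint ballseq (V : choiceType) (e : rel V) (o : V) (n : nat) : seq V :=
  if n is n'.+1 then ballseq e o n' ++ enum_fset (fset_set (level e o n'))
  else [::].

(** In an infinite, locally finite tree no level is empty, so the list has more than k entries and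
    the default o of [nth] is not reached. *)
Definition vertex (V : choiceType) (e : rel V) (o : V) (k : nat) : V :=
  nth o (ballseq e o k.+1) k.

Definition vindex (V : choiceType) (e : rel V) (o v : V) : nat :=
  index v (ballseq e o (dist e o v).+1).

Section Levels.
Variables (V : choiceType) (e : rel V) (o : V).
Hypothesis Htree : is_tree e.
Hypothesis Hlocfin : locally_finite e.
Hypothesis Hinf : infinite_set [set: V].

Local Notation parent := (parent e o).
Local Notation fchildren := (fchildren e o).
Local Notation ballseq := (ballseq e o).
Local Notation vertex := (vertex e o).
Local Notation vindex := (vindex e o).
Local Notation dist := (dist e o).
Local Notation level := (level e o).

Lemma parentP w : w <> o -> is_parent e o (parent w) w.
Proof. by move=> wo; exact: (@xgetPex _ o [set v | _] (parent_exists Htree wo)). Qed.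

Lemma is_parentE v w : is_parent e o v w -> parent w = v.
Proof.
move=> vw; have wo := parent_not_root Htree vw.
exact (parent_unique Htree (parentP wo) vw).
Qed.

Lemma dist_parent w : w <> o -> dist w = (dist (parent w)).+1.
Proof. by move=> wo; apply: (parent_dist Htree); exact: parentP. Qed.

Lemma finite_children v : finite_set (children e o v).
Proof. by apply: sub_finite_set (Hlocfin v) => w []. Qed.

Lemma in_fchildren v w : (w \in fchildren v) = (w != o) && (parent w == v).
Proof.
rewrite in_fset_set; last exact: finite_children.
apply/idP/idP => [|/andP[/eqP wo /eqP <-]]; last by apply/mem_set; exact: parentP.
move=> /set_mem vw; rewrite (is_parentE vw) eqxx andbT.
by apply/eqP => wo; exact: (parent_not_root Htree vw wo).
Qed.

Lemma finite_level n : finite_set (level n).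
Proof.
elim: n => [|n IH].
  apply: (@sub_finite_set _ _ [set o]); last exact: finite_set1.
  by move=> v /(dist_eq0 Htree) ->.
apply: (@sub_finite_set _ _ (\bigcup_(v in level n) children e o v)); last first.
  by apply: bigcup_finite => // v _; exact: finite_children.
move=> w dw; have wo : w <> o.
  by move=> wo; move: dw; rewrite /level /= wo (dist_self Htree).
exists (parent w); last exact: parentP.
by have := dist_parent wo; rewrite dw => -[].
Qed.

(** An empty level would be followed by empty levels only, and the tree would be a finite union of
    finite levels. *)
Lemma level_nonempty n : level n !=set0.
Proof.
apply: contrapT => /set0P/negP/negPn/eqP ln0.
have lk0 k : level (n + k)%N = set0.
  elim: k => [|k IH]; first by rewrite addn0.
  rewrite addnS -subset0 => w dw.
  have wo : w <> o.
    by move=> wo; move: dw; rewrite /level /= wo (dist_self Htree).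
  suff : level (n + k)%N (parent w) by rewrite IH.
  by have := dist_parent wo; rewrite dw => -[].
apply: Hinf; apply: (@sub_finite_set _ _ (\bigcup_(m in `I_n) level m)).
  move=> v _; exists (dist v) => //=; rewrite ltnNge; apply/negP => nd.
  by have := lk0 (dist v - n)%N; rewrite subnKC// => /seteqP[/(_ v) + _]; apply.
by apply: bigcup_finite => [|m _]; [exact: finite_II|exact: finite_level].
Qed.

Lemma in_flevel n v : (v \in fset_set (level n)) = (dist v == n).
Proof.
rewrite in_fset_set; last exact: finite_level.
by apply/idP/eqP => [/set_mem|] // dv; exact/mem_set.
Qed.

Lemma mem_ballseq n v : (v \in ballseq n) = (dist v < n)%N.
Proof.
elim: n => [|n IH] //=; rewrite mem_cat IH in_flevel ltnS.
by rewrite [RHS]leq_eqVlt orbC.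
Qed.

Lemma ballseq_uniq n : uniq (ballseq n).
Proof.
elim: n => [|n IH] //=; rewrite cat_uniq IH fset_uniq andbT /=.
by apply/hasPn => v; rewrite in_flevel mem_ballseq => /eqP ->; rewrite ltnn.
Qed.

Lemma ballseq_prefix n m : (n <= m)%N -> exists s, ballseq m = ballseq n ++ s.
Proof.
move=> /subnKC <-; elim: (m - n)%N => [|k [s IH]].
  by exists [::]; rewrite addn0 cats0.
by rewrite addnS /= IH; eexists; rewrite -catA.
Qed.

Lemma size_ballseq n : (n <= size (ballseq n))%N.
Proof.
elim: n => [|n IH] //=; rewrite size_cat -addn1 leq_add// lt0n.
have [v /eqP] := level_nonempty n; rewrite -in_flevel => vn.
apply/eqP => /size0nil s0.
by have : v \in enum_fset (fset_set (level n)) by []; rewrite s0.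
Qed.

Lemma index_ballseq n m v : (dist v < n)%N -> (n <= m)%N ->
  index v (ballseq m) = index v (ballseq n).
Proof.
move=> dv /ballseq_prefix[s ->].
by rewrite index_cat mem_ballseq dv.
Qed.

Lemma vertexK : cancel vertex vindex.
Proof.
move=> k; rewrite /vindex; set v := vertex k.
have dv : (dist v < k.+1)%N.
  by rewrite -mem_ballseq; apply: mem_nth; exact: size_ballseq.
rewrite -(index_ballseq _ dv)//.
by apply: index_uniq; [exact: size_ballseq|exact: ballseq_uniq].
Qed.

Lemma vindexK : cancel vindex vertex.
Proof.
move=> v; rewrite /vertex; set i := vindex v.
have vb : v \in ballseq (dist v).+1 by rewrite mem_ballseq.
have isz : (i < size (ballseq (dist v).+1))%N by rewrite index_mem.
rewrite -[RHS](nth_index o vb) -/(vindex v) -/i.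
case: (leqP i.+1 (dist v).+1) => [|/ltnW] /ballseq_prefix[s ->].
  by rewrite [RHS]nth_cat size_ballseq.
by rewrite nth_cat isz.
Qed.

(** The parent belongs to the prefix that lists the levels above w, and w does not. So a chain can
    draw its spins in the order of the enumeration. *)
Lemma vindex_parent w : w <> o -> (vindex (parent w) < vindex w)%N.
Proof.
move=> wo; have dw := dist_parent wo.
have -> : vindex w = index w (ballseq (dist w).+1) by [].
rewrite dw; have [s bs] : exists s, ballseq (dist (parent w)).+2 =
    ballseq (dist (parent w)).+1 ++ s by exact: ballseq_prefix.
rewrite bs index_cat mem_ballseq dw ltnn.
by apply: ltn_addr; rewrite index_mem mem_ballseq.
Qed.

Lemma vertex0 : vertex 0 = o.
Proof.
apply: contrapT => vo; have := vindex_parent vo.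
by rewrite vertexK.
Qed.

Lemma parent_root : parent o = o.
Proof.
apply: xgetPN => v vo; exact: (parent_not_root Htree vo erefl).
Qed.

Lemma vindex_parent_le w : (vindex (parent w) <= vindex w)%N.
Proof.
have [->|/eqP wo] := eqVneq w o; first by rewrite parent_root.
exact: ltnW (vindex_parent wo).
Qed.

End Levels.

(** * Cylinders and the product sigma-algebra *)

Definition update (V : choiceType) (xi : V -> bool) (v : V) (b : bool) : V -> bool :=
  fun u => if u == v then b else xi u.

(** With K the whole vertex set these are the cylinders on which a chain is prescribed; with K the
    complement of a finite set they generate the sigma-algebra of the conditioning. *)
Definition cyl (V : choiceType) (idx : V -> nat) (K : set V) (k : nat)
    (xi : V -> bool) : set (V -> bool) :=
  [set eta | forall v, K v -> (idx v < k)%N -> eta v = xi v].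

Section Cylinders.
Variables (V : choiceType) (vtx : nat -> V) (idx : V -> nat).
Hypothesis vtxK : cancel vtx idx.
Hypothesis idxK : cancel idx vtx.

Local Notation cyl := (cyl idx).

Definition determined (K : set V) (k : nat) (A : set (V -> bool)) : Prop :=
  forall eta eta', A eta -> cyl K k eta eta' -> A eta'.

Lemma cyl_sym K k xi eta : cyl K k xi eta -> cyl K k eta xi.
Proof. by move=> h v Kv vk; rewrite h. Qed.

Lemma cyl_trans K k xi eta zeta :
  cyl K k xi eta -> cyl K k eta zeta -> cyl K k xi zeta.
Proof. by move=> h1 h2 v Kv vk; rewrite h2// h1. Qed.

Lemma cyl_weaken K K' k k' xi eta : K `<=` K' -> (k <= k')%N ->
  cyl K' k' xi eta -> cyl K k xi eta.
Proof. by move=> KK kk h v Kv vk; apply: h; [exact: KK|exact: leq_trans vk kk]. Qed.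

Lemma cyl0 K xi : cyl K 0 xi = setT.
Proof. by apply/seteqP; split => // eta _ v. Qed.

Lemma cylS K k xi : cyl K k.+1 xi = cyl K k xi `&`
  [set eta | K (vtx k) -> eta (vtx k) = xi (vtx k)].
Proof.
apply/seteqP; split => [eta h|eta [h1 h2] v Kv].
  split=> [v Kv vk|Kk]; first by apply: h => //; exact: ltnW.
  by apply: h => //; rewrite vtxK.
rewrite ltnS leq_eqVlt => /orP[/eqP vk|]; last exact: h1.
by move: Kv h2; rewrite -vk idxK => Kv /(_ Kv).
Qed.

Lemma cyl_split (K : set V) k xi : K (vtx k) ->
  cyl K k xi = cyl K k.+1 (update xi (vtx k) true) `|`
               cyl K k.+1 (update xi (vtx k) false).
Proof.
move=> Kk; have upd b v : (idx v < k)%N -> update xi (vtx k) b v = xi v.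
  by rewrite /update; case: eqP => // ->; rewrite vtxK ltnn.
rewrite !cylS; apply/seteqP; split => [eta h|eta []].
- case E: (eta (vtx k)); [left|right]; split => [v Kv vk|_].
  + by rewrite upd ?h.
  + by rewrite /update eqxx.
  + by rewrite upd ?h.
  + by rewrite /update eqxx.
- by move=> [h _] v Kv vk; rewrite h// upd.
- by move=> [h _] v Kv vk; rewrite h// upd.
Qed.

Lemma cyl_split_disj (K : set V) k xi : K (vtx k) ->
  cyl K k.+1 (update xi (vtx k) true) `&`
  cyl K k.+1 (update xi (vtx k) false) = set0.
Proof.
move=> Kk; rewrite -subset0 => eta [/(_ _ Kk) h1 /(_ _ Kk) h2].
by move: h1 h2; rewrite vtxK ltnSn /update eqxx => -> // /(_ isT).
Qed.

(** An event that depends on finitely many coordinates is a finite disjoint union of cylinders. *)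
Lemma determined_ind (K : set V) k (P : set (V -> bool) -> Prop) A :
  determined K k A -> P set0 -> (forall xi, A xi -> P (cyl K k xi)) ->
  (forall B C, P B -> P C -> B `&` C = set0 -> P (B `|` C)) -> P A.
Proof.
move=> dA P0 Pc PU.
(* The depth k - n decreases along the induction: at depth k a cylinder lies in A or misses it, and
   a shallower cylinder is split by the spin of the next vertex whenever that vertex is in K. *)
suff gen n xi : (n <= k)%N -> P (A `&` cyl K (k - n) xi).
  by have := gen k (fun=> false) (leqnn _); rewrite subnn cyl0 setIT.
elim: n xi => [|n IH] xi nk.
  rewrite subn0; have [Axi|nAxi] := pselect (A xi).
    rewrite setIidr; first exact: Pc.
    by move=> eta; exact: dA.
  rewrite (_ : _ `&` _ = set0)// -subset0 => eta [Aeta h].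
  by apply: nAxi; apply: dA Aeta _; exact: cyl_sym.
have kn : (k - n = (k - n.+1).+1)%N by rewrite -subSn.
have nk' := ltnW nk.
have [Kk|nKk] := pselect (K (vtx (k - n.+1))).
  rewrite cyl_split// -kn setIUr; apply: PU; [exact: IH|exact: IH|].
  by rewrite setIACA setIid kn cyl_split_disj// setI0.
have := IH xi nk'; rewrite kn cylS; congr (P (_ `&` _)).
by apply/seteqP; split => [eta []//|eta h]; split.
Qed.

Lemma coordinate_sigma_measurable K (A : set (config V)) :
  coordinate_sigma K A -> measurable A.
Proof.
apply: sub_sigma_algebra2 => B [v _ [b ->]].
by exists v => //; exists b.
Qed.

Lemma coordinate_event_sigma (K : set V) v b : K v ->
  coordinate_sigma K [set eta | eta v = b].
Proof. by move=> Kv; apply: sub_sigma_algebra; exists v => //; exists b. Qed.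

Lemma cyl_coordinate_sigma K k xi : coordinate_sigma K (cyl K k xi).
Proof.
pose T := g_sigma_algebraType (coordinate_events K).
elim: k => [|k IH]; first by rewrite cyl0; exact: (@measurableT _ T).
rewrite cylS; apply: (@measurableI _ T) => //.
have [Kk|nKk] := pselect (K (vtx k)).
  rewrite (_ : [set _ | _] = [set eta | eta (vtx k) = xi (vtx k)]).
    exact: coordinate_event_sigma.
  by apply/seteqP; split => eta /= h //; exact: h.
rewrite (_ : [set _ | _] = setT); first exact: (@measurableT _ T).
by apply/seteqP; split => // eta _ /nKk.
Qed.

Lemma determined_coordinate_sigma K k A :
  determined K k A -> coordinate_sigma K A.
Proof.
pose T := g_sigma_algebraType (coordinate_events K).
move=> dA; apply: determined_ind dA _ _ _.
- exact: (@measurable0 _ T).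
- by move=> xi _; exact: cyl_coordinate_sigma.
- by move=> B C hB hC _; exact: (@measurableU _ T B C hB hC).
Qed.

Lemma cyl_measurable K k xi : measurable (cyl K k xi : set (config V)).
Proof. exact: coordinate_sigma_measurable (@cyl_coordinate_sigma K k xi). Qed.

Lemma determined_measurable K k (A : set (config V)) :
  determined K k A -> measurable A.
Proof. by move=> /determined_coordinate_sigma /coordinate_sigma_measurable. Qed.

Lemma determined_weaken (K K' : set V) k k' A : K `<=` K' -> (k <= k')%N ->
  determined K k A -> determined K' k' A.
Proof. by move=> KK kk dA eta eta' Ae h; apply: (dA _ _ Ae); exact: cyl_weaken h. Qed.

(** The finitely determined events are stable under intersection and generate the sigma-algebra, and
    each of them is a disjoint union of arbitrarily deep cylinders. The threshold k0 serves the DLR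
    equation, which is checked only at depths that cover L. *)
Lemma coordinate_sigma_measure_eq (R : realType) K k0
    (m1 m2 : {measure set (config V) -> \bar R}) :
  (m1 setT < +oo)%E ->
  (forall k xi, (k0 <= k)%N -> m1 (cyl K k xi) = m2 (cyl K k xi)) ->
  forall A, coordinate_sigma K A -> m1 A = m2 A.
Proof.
move=> m1oo m12.
pose G := [set A : set (config V) | exists k, determined K k A].
have Gm : G `<=` measurable by move=> A [k]; exact: determined_measurable.
have GI : setI_closed G.
  move=> A B [k dA] [l dB]; exists (maxn k l) => eta eta' [Ae Be] h; split.
  - by apply: dA Ae _; apply: cyl_weaken h => //; exact: leq_maxl.
  - by apply: dB Be _; apply: cyl_weaken h => //; exact: leq_maxr.
have GT : G setT by exists 0%N.
have G12 A : G A -> m1 A = m2 A.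
  move=> [k dA]; have dA' := determined_weaken (@subset_refl _ K) (leq_maxl k k0) dA.
  pose P (B : set (config V)) := measurable B /\ m1 B = m2 B.
  suff : P A by case.
  apply: (determined_ind (P := P) dA').
  - by split => //; rewrite !measure0.
  - by move=> xi _; split; [exact: cyl_measurable|rewrite m12// leq_maxr].
  - move=> B C [mB eB] [mC eC] BC0; split; first exact: measurableU.
    rewrite !measureU//; by congr (_ + _)%E.
have sub : coordinate_events K `<=` G.
  move=> A [v Kv [b ->]]; exists (idx v).+1 => eta eta' /= <- h.
  by rewrite h.
move=> A /(sub_sigma_algebra2 sub).
apply: (@g_sigma_algebra_measure_unique _ R (config V) G Gm (fun=> setT)) => //.
by rewrite bigcup_const//; exists 0%N.
Qed.

End Cylinders.

(** * Measures with prescribed conditional probabilities *)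

Definition unit_interval_measure (R : realType) :
    set (measurableTypeR R) -> \bar R :=
  mrestr (@lebesgue_measure R) (measurable_itv `[0%R, 1%R[).

HB.instance Definition _ (R : realType) := Measure.on (@unit_interval_measure R).

Lemma unit_interval_measureT (R : realType) :
  @unit_interval_measure R setT = 1%:E.
Proof.
rewrite /unit_interval_measure /mrestr setTI lebesgue_measure_itv /=.
by rewrite lte_fin ltr01 oppr0 adde0.
Qed.

HB.instance Definition _ (R : realType) :=
  Measure_isProbability.Build _ _ R (@unit_interval_measure R)
    (unit_interval_measureT R).

Section SequentialMeasure.
Variables (R : realType) (V : choiceType) (vtx : nat -> V) (idx : V -> nat).
Hypothesis vtxK : cancel vtx idx.
Hypothesis idxK : cancel idx vtx.
Variable q : V -> (V -> bool) -> R.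
Hypothesis q_ge0 : forall v xi, 0 <= q v xi.
Hypothesis q_loc : forall v xi eta,
  (forall u, (idx u <= idx v)%N -> xi u = eta u) -> q v xi = q v eta.
Hypothesis q_sum : forall v xi, q v (update xi v true) + q v (update xi v false) = 1.

Local Notation cyl := (cyl idx setT).

(** The cylinder of xi at depth k corresponds to an interval of this length, starting at [left_end].
    Its part to the left of [mid] gives the spin true to the next vertex. *)
Let len (xi : V -> bool) k : R := \prod_(i < k) q (vtx i) xi.

Let mid_of (l : R) xi k := l + len xi k * q (vtx k) (update xi (vtx k) true).

Fixpoint left_end (xi : V -> bool) (k : nat) : R :=
  if k is k'.+1 then
    if xi (vtx k') then left_end xi k' else mid_of (left_end xi k') xi k'
  else 0.

Let mid xi k := mid_of (left_end xi k) xi k.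

Fixpoint decode_prefix (x : R) (k : nat) : V -> bool :=
  if k is k'.+1 then
    let xi := decode_prefix x k' in update xi (vtx k') (x < mid xi k')
  else fun=> false.

Let unit : set R := `[0%R, 1%R[%classic.

(* Subdividing [0, 1[ according to the conditional probabilities q encodes the
   configuration drawn by a uniform point. *)
Definition decode (x : R) : config V :=
  if x \in unit then fun v => decode_prefix x (idx v).+1 v else fun=> false.

Let len_ge0 xi k : 0 <= len xi k.
Proof. exact: prodr_ge0. Qed.

Let len_loc xi eta k : cyl k xi eta -> len eta k = len xi k.
Proof.
move=> h; apply: eq_bigr => i _; apply: q_loc => u.
by rewrite vtxK => ui; apply: h => //; exact: leq_ltn_trans ui _.
Qed.

Let mid_of_loc xi eta k l : cyl k xi eta -> mid_of l eta k = mid_of l xi k.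
Proof.
move=> h; rewrite /mid_of (len_loc h); congr (_ + _ * _).
apply: q_loc => u; rewrite vtxK leq_eqVlt /update => /orP[/eqP <-|uk].
  by rewrite idxK eqxx.
by rewrite h.
Qed.

Let left_end_loc xi eta k : cyl k xi eta -> left_end eta k = left_end xi k.
Proof.
elim: k => [|k IH] //= h.
have h' : cyl k xi eta by apply: cyl_weaken h.
rewrite h ?vtxK// IH//; case: ifP => // _; exact: mid_of_loc.
Qed.

Let mid_loc xi eta k : cyl k xi eta -> mid eta k = mid xi k.
Proof. by move=> h; rewrite /mid (left_end_loc h) (mid_of_loc _ h). Qed.

Let decode_cyl x k : unit x -> cyl k (decode x) (decode_prefix x k).
Proof.
move=> ux; elim: k => [|k IH] v _ //=.
rewrite ltnS leq_eqVlt /update => /orP[/eqP vk|vk].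
  by rewrite -vk idxK eqxx /decode mem_set//= /update idxK eqxx.
by rewrite (_ : (v == _) = false) ?IH//; apply: contraTF vk => /eqP ->; rewrite vtxK ltnn.
Qed.

Let decode_vtx x k : unit x -> decode x (vtx k) = (x < mid (decode x) k).
Proof.
move=> ux; rewrite [in LHS]/decode mem_set//= vtxK /update eqxx.
by rewrite (mid_loc (decode_cyl ux)).
Qed.

Let q_update v xi : q v (update xi v (xi v)) = q v xi.
Proof. by apply: q_loc => u _; rewrite /update; case: eqP => // ->. Qed.

(** By induction on the depth: the spin decoded at the next vertex tells on which side of the
    division point x lies, and by [q_sum] the two parts fill the interval. *)
Let decode_itv x k xi : unit x ->
  cyl k xi (decode x) <-> left_end xi k <= x < left_end xi k + len xi k.
Proof.
move=> ux; elim: k => [|k IH].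
  by rewrite cyl0 /= /len big_ord0 add0r; split => // _; move: ux; rewrite /unit /= in_itv.
have lenS : len xi k.+1 = len xi k * q (vtx k) xi by rewrite /len big_ord_recr.
have qs := q_sum (vtx k) xi; have qu := q_update (vtx k) xi.
have qt0 := q_ge0 (vtx k) (update xi (vtx k) true).
have qf0 := q_ge0 (vtx k) (update xi (vtx k) false).
have l0 := len_ge0 xi k.
rewrite (cylS vtxK idxK) /= lenS; split.
  move=> [hk /(_ I)]; rewrite decode_vtx// (mid_loc hk) /mid /mid_of => xk.
  have /andP[h1 h2] := (IH.1 hk).
  move: qu; rewrite -xk; case: ltP => /= h3 <-; first by rewrite h1 h3.
  rewrite h3 /=; move: h2; congr (_ < _).
  by rewrite -addrA -mulrDr qs mulr1.
move=> h; have hI : left_end xi k <= x < left_end xi k + len xi k.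
  move: h qu; case: ifP => _ /andP[h1 h2] qu; rewrite -qu in h2.
    rewrite h1 /=; apply: (lt_le_trans h2); rewrite lerD2l.
    by rewrite ler_piMr// -qs lerDl.
  rewrite (le_trans _ h1) /mid_of ?lerDl ?mulr_ge0//=.
  by move: h2; rewrite /mid_of -addrA -mulrDr qs mulr1.
have hk := IH.2 hI; split => // _.
rewrite decode_vtx// (mid_loc hk) /mid; move: h qu.
case: ifP => _ /andP[h1 h2] qu; rewrite -qu in h2; first exact: h2.
by apply/negbTE; rewrite -leNgt.
Qed.

Let decode_cylE k xi : unit `&` decode @^-1` (cyl k xi) =
  unit `&` `[left_end xi k, left_end xi k + len xi k[%classic.
Proof.
apply/seteqP; split => x [ux h]; split => //.
  by rewrite /= in_itv /=; exact/decode_itv.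
by apply/decode_itv => //; move: h; rewrite /= in_itv.
Qed.

(** Inside the unit interval a coordinate event pulls back to a finite union of intervals; outside
    it [decode] is constant. *)
Let measurable_decode : measurable_fun setT (decode : measurableTypeR R -> config V).
Proof.
have mu : measurable (unit : set (measurableTypeR R)) by exact: measurable_itv.
apply: (@measurability _ _ (measurableTypeR R) (config V) setT decode
  (coordinate_events setT) erefl).
move=> _ [_ [v _ [b ->]] <-]; rewrite setTI.
set E := [set _ | _].
have -> : decode @^-1` E = (unit `&` decode @^-1` E) `|`
    (~` unit `&` [set _ | E (fun=> false)]).
  apply/seteqP; split => [x Ex|x [[]//|[ux /= Ef]]].
    have [ux|ux] := pselect (unit x); [by left|right]; split => //.
    by move: Ex; rewrite /= /decode memNset.
  by rewrite /= /decode memNset.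
apply: measurableU; last first.
  apply: measurableI; first exact: measurableC.
  have [h|h] := pselect (E (fun=> false)).
    by rewrite (_ : [set _ | _] = setT)//; apply/seteqP; split.
  by rewrite (_ : [set _ | _] = set0)//; apply/seteqP; split.
pose P (B : set (V -> bool)) :=
  measurable (unit `&` decode @^-1` B : set (measurableTypeR R)).
have dE : determined idx setT (idx v).+1 E by move=> eta eta' Ee h; rewrite /E /= h.
apply: (determined_ind vtxK idxK (P := P) dE).
- by rewrite /P preimage_set0 setI0.
- move=> xi _; rewrite /P decode_cylE; apply: measurableI; first exact: mu.
  exact: measurable_itv.
- by move=> B C PB PC _; rewrite /P preimage_setU setIUr; exact: measurableU.
Qed.

Let left_end_unit k xi : 0 <= left_end xi k /\ left_end xi k + len xi k <= 1.
Proof.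
elim: k => [|k [IH1 IH2]] /=; first by rewrite /len big_ord0 add0r.
have lenS : len xi k.+1 = len xi k * q (vtx k) xi by rewrite /len big_ord_recr.
have qs := q_sum (vtx k) xi; have qu := q_update (vtx k) xi.
have qt0 := q_ge0 (vtx k) (update xi (vtx k) true).
have qf0 := q_ge0 (vtx k) (update xi (vtx k) false).
have l0 := len_ge0 xi k.
rewrite lenS; move: qu; case: ifP => _ <-; split => //.
- by apply: le_trans IH2; rewrite lerD2l ler_piMr// -qs lerDl.
- by rewrite /mid_of addr_ge0// mulr_ge0.
- by rewrite /mid_of -addrA -mulrDr qs mulr1.
Qed.

(** The measure is the law of [decode] at a uniform point: a cylinder pulls back to an interval
    whose length is the product. *)
Lemma sequential_measure : exists P : probability (config V) R,
  forall k xi, P (cyl k xi) = (\prod_(i < k) q (vtx i) xi)%:E.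
Proof.
pose D : {mfun measurableTypeR R >-> config V} := HB.pack
  (decode : measurableTypeR R -> config V)
  (isMeasurableFun.Build _ _ _ _ _ measurable_decode).
exists (distribution (@unit_interval_measure R) D) => k xi.
rewrite /distribution /pushforward /= /unit_interval_measure /mrestr.
rewrite setIC (decode_cylE k xi) -/(len xi k).
have [l0 l1] := left_end_unit k xi; have len0 := len_ge0 xi k.
rewrite setIidr; last first.
  move=> x; rewrite /unit /= !in_itv /= => /andP[h1 h2].
  by rewrite (le_trans l0 h1) (lt_le_trans h2 l1).
rewrite lebesgue_measure_itv /= lte_fin ltrDl.
case: ltP => [_|le0]; first by rewrite -EFinD [X in X - _]addrC addrK.
by congr EFin; apply/eqP; rewrite eq_le len0 le0.
Qed.

End SequentialMeasure.

(** * Markov chains on the tree and the DLR equations *)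

Lemma tanh_lt1 (R : realType) (x : R) : `|tanh x| < 1.
Proof.
have e0 := expR_gt0 x; have f0 := expR_gt0 (- x).
have d0 : 0 < expR x + expR (- x) by rewrite addr_gt0.
rewrite ltr_norml /tanh ltr_pdivlMr// ltr_pdivrMr// mul1r mulN1r.
by apply/andP; split; lra.
Qed.

(** The product of two spins is 1 or -1, so the exponential is cosh x times 1 plus or minus tanh x.
    The cosh factor does not depend on the spins and cancels in the Gibbs kernel. *)
Lemma expR_mul_spin (R : realType) (x : R) (a b : bool) :
  expR (x * spin R a * spin R b) =
  (expR x + expR (- x)) / 2 * (1 + tanh x * spin R a * spin R b).
Proof.
have d0 : expR x + expR (- x) != 0.
  by rewrite gt_eqF// addr_gt0// expR_gt0.
rewrite /tanh; case: a; case: b;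
  by rewrite /spin ?mulrN1 ?opprK ?mulr1; field.
Qed.

Lemma spin_norm (R : realType) b : `|spin R b| = 1.
Proof. by case: b; rewrite /spin ?normrN normr1. Qed.

Section Chain.
Variables (R : realType) (V : choiceType) (e : rel V) (o : V).
Variables (J : V -> R) (beta : R).
Hypothesis Htree : is_tree e.
Hypothesis Hlocfin : locally_finite e.
Hypothesis Hinf : infinite_set [set: V].

Local Notation par := (parent e o).
Local Notation fch := (fchildren e o).
Local Notation vtx := (vertex e o).
Local Notation idx := (vindex e o).
Local Notation dist := (dist e o).
Local Notation cyl := (cyl (vindex e o)).
Local Notation sp := (spin R).

Let vtxK := vertexK o Htree Hlocfin Hinf.
Let idxK := vindexK o Htree Hlocfin Hinf.

(* The value at the root, which has no parent edge, makes the factor of the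
   root in the kernel below neutral. *)
Definition edge_theta (v : V) : R := if v == o then 0 else tanh (beta * J v).

Local Notation th := edge_theta.

Lemma edge_theta_lt1 v : `|th v| < 1.
Proof. by rewrite /th; case: eqP => _; rewrite ?normr0 ?ltr01 ?tanh_lt1. Qed.

Lemma edge_factor_gt0 v (x : R) : `|x| <= 1 -> 0 < 1 + th v * x.
Proof.
move=> x1; have := edge_theta_lt1 v => t1.
have : `|th v * x| < 1.
  rewrite normrM; apply: le_lt_trans t1.
  by rewrite ler_piMr.
by rewrite ltr_norml => /andP[h _]; rewrite -ltrBlDl sub0r.
Qed.

(** The denominator is the sum of the numerator over the two spins at v. At the root [edge_theta] is
    0, and what remains is the law of a spin with mean m o. *)
Definition chain_kernel (m : V -> R) (v : V) (xi : V -> bool) : R :=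
  (1 + th v * (sp (xi (par v)) * sp (xi v))) * (1 + sp (xi v) * m v) /
  (2 * (1 + th v * (sp (xi (par v)) * m v))).

Definition is_chain (m : V -> R) (P : probability (config V) R) : Prop :=
  forall k xi, P (cyl setT k xi) = (\prod_(i < k) chain_kernel m (vtx i) xi)%:E.

Lemma spin_mul_le1 (b : bool) (x : R) : `|x| <= 1 -> `|sp b * x| <= 1.
Proof. by move=> x1; rewrite normrM spin_norm mul1r. Qed.

Lemma spin_le1 b : `|sp b| <= 1. Proof. by rewrite spin_norm. Qed.

Lemma field_factor_ge0 (b : bool) (x : R) : `|x| <= 1 -> 0 <= 1 + sp b * x.
Proof.
move=> /(spin_mul_le1 b); rewrite ler_norml => /andP[h _].
by rewrite -lerBlDl sub0r.
Qed.

Lemma chain_kernel_ge0 m v xi : `|m v| <= 1 -> 0 <= chain_kernel m v xi.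
Proof.
move=> m1; rewrite /chain_kernel divr_ge0// mulr_ge0//.
- by apply/ltW/edge_factor_gt0/spin_mul_le1/spin_le1.
- exact: field_factor_ge0.
- by apply/ltW/edge_factor_gt0/spin_mul_le1.
Qed.

Lemma chain_measure_exists m : (forall v, `|m v| <= 1) ->
  exists P, is_chain m P.
Proof.
move=> m1; apply: (sequential_measure vtxK idxK).
- by move=> v xi; exact: chain_kernel_ge0.
- move=> v xi eta h; rewrite /chain_kernel !h//.
  exact: vindex_parent_le.
(* The root is its own parent by the default of [parent], so updating it changes both spins in the
   kernel; the zero value of [edge_theta] there removes the edge factor. *)
move=> v xi; have [vo|vo] := eqVneq v o.
  by rewrite /chain_kernel /th vo eqxx /update eqxx /spin; field.
have pv : (par v == v) = false.
  apply/eqP => pv; have := vindex_parent Htree Hlocfin (elimN eqP vo).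
  by rewrite pv ltnn.
rewrite /chain_kernel /update eqxx pv.
have := @edge_factor_gt0 v (sp (xi (par v)) * m v) (spin_mul_le1 _ (m1 v)).
by rewrite /spin; case: (xi (par v)) => /lt0r_neq0 h; field; rewrite ?mul1r in h.
Qed.

Definition first_vertices (k : nat) : seq V := [seq vtx i | i <- iota 0 k].

Lemma mem_first_vertices k v : (v \in first_vertices k) = (idx v < k)%N.
Proof.
apply/mapP/idP => [[i + ->]|vk]; first by rewrite mem_iota /= vtxK.
by exists (idx v); rewrite ?mem_iota ?idxK.
Qed.

Lemma first_vertices_uniq k : uniq (first_vertices k).
Proof. by rewrite map_inj_uniq ?iota_uniq//; exact: can_inj vtxK. Qed.

Lemma prod_first_vertices k (F : V -> R) :
  \prod_(i < k) F (vtx i) = \prod_(v <- first_vertices k) F v.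
Proof.
rewrite /first_vertices big_map -(big_mkord xpredT (fun i => F (vtx i))).
by rewrite /index_iota subn0.
Qed.

(** Each vertex but the root has exactly one parent, and the parent comes earlier. The regrouping
    collects the denominators at the children of v, to which the recursion at v applies. *)
Lemma prod_by_parent k (F : V -> R) : F o = 1 ->
  \prod_(w <- first_vertices k) F w =
  \prod_(v <- first_vertices k)
     \prod_(w <- first_vertices k | (w != o) && (par w == v)) F w.
Proof.
move=> Fo; under [RHS]eq_bigr do rewrite big_mkcond /=.
rewrite exchange_big /= big_seq [RHS]big_seq; apply: eq_bigr => w wk.
have [->|wo] := eqVneq w o; first by rewrite big1.
have pk : par w \in first_vertices k.
  move: wk; rewrite !mem_first_vertices; apply: leq_ltn_trans.
  exact: vindex_parent_le.
rewrite (bigD1_seq (par w)) ?first_vertices_uniq//= eqxx big1 ?mulr1//.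
by move=> v; rewrite eq_sym => /negbTE ->.
Qed.

(** Since parents come earlier in the enumeration, depth k then contains both ends of every edge
    that touches L. *)
Definition covers (L : {fset V}) (k : nat) : Prop := forall v, v \in L ->
  (idx v < k)%N /\ forall w, w \in fch v -> (idx w < k)%N.

Lemma covers_exists L : exists k, forall k', (k <= k')%N -> covers L k'.
Proof.
exists (\max_(v <- L) maxn (idx v).+1 (\max_(w <- fch v) (idx w).+1)) => k' kk v vL.
split=> [|w wv]; apply: leq_trans kk; rewrite (big_rem v)//= !leq_max ?leqnn//.
by rewrite (big_rem w)//= leq_max leqnn !orbT.
Qed.

Lemma prod_children L k (F : V -> R) v : covers L k -> v \in L ->
  \prod_(w <- first_vertices k | (w != o) && (par w == v)) F w =
  \prod_(w <- fch v) F w.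
Proof.
move=> cLk vL; rewrite -big_filter; apply: perm_big; apply: uniq_perm.
- by rewrite filter_uniq// first_vertices_uniq.
- exact: fset_uniq.
move=> w; rewrite mem_filter mem_first_vertices -(in_fchildren o Htree Hlocfin).
by apply/andP/idP => [[]//|wv]; split => //; exact: (cLk v vL).2.
Qed.

Definition touching (L : {fset V}) (k : nat) : pred V :=
  fun w => (w != o) && ((w \in L) || (par w \in L)).

Lemma touching_idx L k w : covers L k -> touching L k w -> (idx w < k)%N.
Proof.
move=> cLk /andP[wo /orP[/cLk[]//|/cLk[_]]]; apply.
by rewrite in_fchildren// wo eqxx.
Qed.

Lemma boltzmann_weightE L k xi : covers L k ->
  boltzmann_weight e o J beta L xi =
  \prod_(w <- first_vertices k | touching L k w)
    ((expR (beta * J w) + expR (- (beta * J w))) / 2) *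
  \prod_(w <- first_vertices k | touching L k w)
    (1 + th w * (sp (xi (par w)) * sp (xi w))).
Proof.
move=> cLk; rewrite -big_split /= /boltzmann_weight.
pose s := [seq (par w, w) | w <- first_vertices k & touching L k w].
have us : uniq s.
  by rewrite map_inj_uniq ?filter_uniq ?first_vertices_uniq// => u v [].
have -> : touching_edges e o L = [set` s].
  apply/seteqP; split => [[v w] /= [vw vwL]|[v w] /= /mapP[u]].
    have wo := parent_not_root Htree vw.
    have pw := is_parentE Htree vw; apply/mapP; exists w; last by rewrite pw.
    have tw : touching L k w.
      by apply/andP; split; [exact/eqP|case: vwL; rewrite pw /= => ->; rewrite ?orbT].
    by rewrite mem_filter tw mem_first_vertices (touching_idx cLk).
  rewrite mem_filter => /andP[/andP[/eqP uo uL] _] [-> ->].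
  by split; [exact: parentP|case/orP: uL; [right|left]].
rewrite -fsbig_seq// big_map big_filter mulr_sumr expR_sum.
apply: eq_bigr => w /andP[wo _] /=.
by rewrite !mulrA expR_mul_spin /th (negbTE wo).
Qed.

(** The belief propagation equation at v. The constant c is free but common to both spins, since
    only the dependence on the spin at v matters. *)
Definition satisfies_recursion (m : V -> R) (v : V) : Prop :=
  exists2 c : R, 0 < c & forall b : bool,
    \prod_(w <- fch v) (1 + th w * (sp b * m w)) = c * (1 + sp b * m v).

(** As functions of the spins in L, chain probability and Boltzmann weight are proportional: they
    share the edge factors that touch L, the other edge factors do not see L, and the recursion
    cancels the field factors against the denominators. *)
Lemma chain_kernel_ratio (m : V -> R) (L : {fset V}) k (xi eta : V -> bool) :
  (forall v, `|m v| <= 1) -> (forall v, v \in L -> satisfies_recursion m v) ->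
  covers L k -> (forall v, v \notin L -> xi v = eta v) ->
  (\prod_(i < k) chain_kernel m (vtx i) xi) * boltzmann_weight e o J beta L eta =
  (\prod_(i < k) chain_kernel m (vtx i) eta) * boltzmann_weight e o J beta L xi.
Proof.
move=> m1 mL cLk xe.
pose A x := \prod_(w <- first_vertices k | touching L k w)
   (1 + th w * (sp (x (par w)) * sp (x w))).
pose B x := \prod_(w <- first_vertices k | ~~ touching L k w)
   (1 + th w * (sp (x (par w)) * sp (x w))).
pose N x := \prod_(w <- first_vertices k) (1 + sp (x w) * m w).
pose D x := \prod_(w <- first_vertices k) (1 + th w * (sp (x (par w)) * m w)).
have D0 x : D x != 0.
  rewrite /D prodf_seq_neq0; apply/allP => w _ /=.
  by rewrite gt_eqF// edge_factor_gt0// spin_mul_le1.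
have kerE x : \prod_(i < k) chain_kernel m (vtx i) x =
    2^-1 ^+ k * (A x * B x) * N x / D x.
  rewrite (prod_first_vertices k (fun v => chain_kernel m v x)) /chain_kernel.
  rewrite big_split /= big_split /=.
  have -> : A x * B x = \prod_(w <- first_vertices k)
      (1 + th w * (sp (x (par w)) * sp (x w))).
    by rewrite [RHS](bigID (touching L k)).
  rewrite prodfV big_split /=.
  rewrite big_const_seq count_predT size_map size_iota.
  rewrite iter_mulr_1 invfM exprVn.
  by rewrite -/(N x) -/(D x); ring.
have BE : B xi = B eta.
  rewrite /B; apply: eq_bigr => w; rewrite /touching negb_and negbK.
  case: eqP => [->|_] /=; first by rewrite /th eqxx !mul0r.
  by rewrite negb_or => /andP[wL pL]; rewrite !xe.
(* The denominator at a child involves only the spin of its parent v. Grouped by v, the denominators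
   equal c times the field factor of v when v is in L, and xi and eta agree at the other v. *)
have ND : N xi * D eta = N eta * D xi.
  have DE x : D x = \prod_(v <- first_vertices k)
    \prod_(w <- first_vertices k | (w != o) && (par w == v))
       (1 + th w * (sp (x v) * m w)).
    rewrite /D prod_by_parent; last by rewrite /th eqxx mul0r addr0.
    by apply: eq_bigr => v _; apply: eq_bigr => w /andP[_ /eqP ->].
  rewrite !DE /N -!big_split /=; apply: eq_bigr => v _.
  have [vL|vL] := boolP (v \in L); last by rewrite xe.
  rewrite !(prod_children _ cLk vL).
  by have [c c0 cE] := mL v vL; rewrite !cE; ring.
rewrite !kerE !(boltzmann_weightE _ cLk) -/(A xi) -/(A eta) BE.
have -> : N xi = N eta * D xi / D eta by rewrite -ND mulfK.
by field; rewrite !D0.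
Qed.

End Chain.

(** * Finite-volume kernels and the Gibbs property of chains *)

Section ChainGibbs.
Variables (R : realType) (V : choiceType) (e : rel V) (o : V).
Variables (J : V -> R) (beta : R).
Hypothesis Htree : is_tree e.
Hypothesis Hlocfin : locally_finite e.
Hypothesis Hinf : infinite_set [set: V].

Local Notation par := (parent e o).
Local Notation fch := (fchildren e o).
Local Notation vtx := (vertex e o).
Local Notation idx := (vindex e o).
Local Notation cyl := (cyl (vindex e o)).
Local Notation sp := (spin R).
Local Notation covers := (covers e o).
Local Notation weight := (boltzmann_weight e o J beta).
Local Notation kernel := (gibbs_kernel e o J beta).
Local Notation is_chain := (is_chain e o J beta).
Local Notation satisfies_recursion := (satisfies_recursion e o J beta).

Let vtxK := vertexK o Htree Hlocfin Hinf.
Let idxK := vindexK o Htree Hlocfin Hinf.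

Definition spin_event (L : {fset V}) (sigma : {ffun L -> bool}) :
  set (config V) := [set eta | forall u : L, eta (val u) = sigma u].

Definition outside (L : {fset V}) : set V := ~` [set` L].

Lemma outsideP (L : {fset V}) v : outside L v <-> v \notin L.
Proof. by split => [h|/negP h]; [apply/negP|]. Qed.

Lemma glue_in (L : {fset V}) (sigma : {ffun L -> bool}) xi (u : L) :
  Defs.glue sigma xi (val u) = sigma u.
Proof. by rewrite /Defs.glue valK. Qed.

Lemma glue_out (L : {fset V}) (sigma : {ffun L -> bool}) xi v :
  v \notin L -> Defs.glue sigma xi v = xi v.
Proof. by move=> vL; rewrite /Defs.glue insubN. Qed.

Lemma spin_event_glue (L : {fset V}) (sigma : {ffun L -> bool}) xi :
  spin_event sigma (Defs.glue sigma xi).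
Proof. by move=> u; rewrite glue_in. Qed.

Lemma spin_event_eq (L : {fset V}) (sigma : {ffun L -> bool}) xi eta v :
  spin_event sigma xi -> spin_event sigma eta -> v \in L -> xi v = eta v.
Proof.
move=> hx he vL; have := hx (FSetSub vL); have := he (FSetSub vL).
by move=> /= -> ->.
Qed.

Lemma glue_cyl (L : {fset V}) (sigma : {ffun L -> bool}) k xi :
  (forall v, v \in L -> (idx v < k)%N) ->
  cyl setT k (Defs.glue sigma xi) = spin_event sigma `&` cyl (outside L) k xi.
Proof.
move=> Lk; apply/seteqP; split => [eta h|eta [h1 h2] v _ vk].
  split => [u|v /outsideP vL vk]; last by rewrite h// glue_out.
  by rewrite h ?glue_in//; apply: Lk; exact: valP.
have [vL|vL] := boolP (v \in L); last by rewrite glue_out// h2//; exact/outsideP.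
exact: spin_event_eq h1 (spin_event_glue sigma xi) vL.
Qed.

Lemma spin_event_determined (L : {fset V}) (sigma : {ffun L -> bool}) k :
  (forall v, v \in L -> (idx v < k)%N) ->
  determined idx setT k (spin_event sigma).
Proof. by move=> Lk eta eta' h1 h2 u; rewrite h2// ?h1//; exact/Lk/valP. Qed.

Lemma measurable_spin_event (L : {fset V}) (sigma : {ffun L -> bool}) :
  measurable (spin_event sigma).
Proof.
have [k ck] := covers_exists e o L.
apply: (determined_measurable vtxK idxK (spin_event_determined (k := k) _)) => v vL.
by have [] := ck k (leqnn k) v vL.
Qed.

Lemma measure_spin_events (mu : {measure set (config V) -> \bar R})
    (L : {fset V}) (C : set (config V)) : measurable C ->
  mu C = (\sum_(sigma : {ffun L -> bool}) mu (spin_event sigma `&` C))%E.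
Proof.
move=> mC.
have {1}-> : C = \bigcup_(sigma in [set: {ffun L -> bool}])
    (spin_event sigma `&` C).
  apply/seteqP; split => [eta Ce|eta [sigma _ []]//].
  exists [ffun u => eta (val u)] => //; split => // u; by rewrite ffunE.
rewrite measure_fin_bigcup; [|exact: finite_finset| |].
- rewrite (fsbigE (enum {ffun L -> bool})) ?enum_uniq//; last first.
    by move=> i _; rewrite mem_enum.
  by rewrite big_enum_cond /=; apply: eq_bigl => i; rewrite in_setT.
- move=> s t _ _ [eta [[hs _] [ht _]]]; apply/ffunP => u.
  by rewrite -hs -ht.
- by move=> s _; apply: measurableI => //; exact: measurable_spin_event.
Qed.

Lemma weight_gt0 L xi : 0 < weight L xi.
Proof. exact: expR_gt0. Qed.

Lemma partition_gt0 (L : {fset V}) xi :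
  0 < \sum_(tau : {ffun L -> bool}) weight L (Defs.glue tau xi).
Proof.
rewrite (bigD1 [ffun=> true])//= ltr_wpDr ?weight_gt0//.
by apply: sumr_ge0 => i _; exact/ltW/weight_gt0.
Qed.

Lemma kernel_ge0 (L : {fset V}) (sigma : {ffun L -> bool}) xi :
  0 <= kernel sigma xi.
Proof. by rewrite divr_ge0// ltW// ?weight_gt0 ?partition_gt0. Qed.

Lemma kernel_le1 (L : {fset V}) (sigma : {ffun L -> bool}) xi :
  kernel sigma xi <= 1.
Proof.
rewrite /gibbs_kernel ler_pdivrMr ?partition_gt0// mul1r.
rewrite [leRHS](bigD1 sigma)//= lerDl.
by apply: sumr_ge0 => i _; exact/ltW/weight_gt0.
Qed.

Lemma weight_loc (L : {fset V}) k xi eta : covers L k ->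
  (forall v, (idx v < k)%N -> xi v = eta v) -> weight L xi = weight L eta.
Proof.
move=> cLk h; rewrite !(boltzmann_weightE J beta Htree Hlocfin Hinf _ cLk).
congr (_ * _); rewrite big_seq_cond [RHS]big_seq_cond.
apply: eq_bigr => w /andP[]; rewrite mem_first_vertices// => wk _.
by rewrite !h//; apply: leq_ltn_trans wk; exact: vindex_parent_le.
Qed.

(** Only edges that touch L enter, so the kernel is a function of finitely many spins outside L; its
    measurability rests on this. *)
Lemma kernel_loc (L : {fset V}) (sigma : {ffun L -> bool}) k xi eta :
  covers L k -> cyl (outside L) k xi eta -> kernel sigma eta = kernel sigma xi.
Proof.
move=> cLk h.
have gE (tau : {ffun L -> bool}) : weight L (Defs.glue tau eta) = weight L (Defs.glue tau xi).
  apply: (weight_loc cLk) => v vk; rewrite /Defs.glue; case: insubP => // vL.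
  by apply: h => //; apply/outsideP.
by rewrite /gibbs_kernel gE; congr (_ / _); apply: eq_bigr => tau _.
Qed.

Lemma kernel_coordinate_sigma (L : {fset V}) (sigma : {ffun L -> bool}) (B : set R) :
  coordinate_sigma (outside L) (kernel sigma @^-1` B).
Proof.
have [k ck] := covers_exists e o L.
apply: (determined_coordinate_sigma vtxK idxK (k := k)) => eta eta' h1 h2.
by rewrite /preimage /= (kernel_loc sigma (ck k (leqnn k)) h2).
Qed.

Lemma kernel_measurable (L : {fset V}) (sigma : {ffun L -> bool}) :
  measurable_fun setT (kernel sigma : config V -> R).
Proof.
move=> _ B mB; rewrite setTI; apply: (coordinate_sigma_measurable (K := outside L)).
exact: kernel_coordinate_sigma.
Qed.

Lemma kernel_integrable (mu : probability (config V) R)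
  (L : {fset V}) (sigma : {ffun L -> bool}) :
  mu.-integrable setT (EFin \o (kernel sigma : config V -> R)).
Proof.
apply: measurable_bounded_integrable => //.
- by rewrite (le_lt_trans (probability_le1 mu measurableT))// ltry.
- exact: kernel_measurable.
exists 1; split => // M M1 eta _ /=.
by rewrite ger0_norm ?kernel_ge0// (le_trans (kernel_le1 _ _))// ltW.
Qed.

(** Summing [chain_kernel_ratio] over the configurations in L turns one weight into the partition
    function, which gives the DLR equation on cylinders outside L. *)
Lemma chain_cond_cyl m (P : probability (config V) R) (L : {fset V})
    (sigma : {ffun L -> bool}) k xi :
  (forall v, `|m v| <= 1) -> (forall v, v \in L -> satisfies_recursion m v) ->
  is_chain m P -> covers L k ->
  (P (spin_event sigma `&` cyl (outside L) k xi) =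
   (kernel sigma xi)%:E * P (cyl (outside L) k xi))%E.
Proof.
move=> m1 mL cP cLk.
have Lk v : v \in L -> (idx v < k)%N by move=> /cLk[].
pose p (tau : {ffun L -> bool}) :=
  \prod_(i < k) chain_kernel e o J beta m (vtx i) (Defs.glue tau xi).
have PE tau : P (spin_event tau `&` cyl (outside L) k xi) = (p tau)%:E.
  by rewrite -(glue_cyl _ _ Lk) cP.
have mC : measurable (cyl (outside L) k xi : set (config V)).
  exact: (@cyl_measurable _ _ _ vtxK idxK (outside L) k xi).
have -> : P (cyl (outside L) k xi) = (\sum_tau (p tau)%:E)%E.
  transitivity (\sum_(tau : {ffun L -> bool})
      P (spin_event tau `&` cyl (outside L) k xi))%E.
    exact: measure_spin_events.
  by apply: eq_bigr => tau _; exact: PE.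
rewrite PE sumEFin -EFinM; congr EFin.
have Z0 := partition_gt0 L xi.
rewrite /gibbs_kernel mulrAC; apply/(canRL (mulfK (lt0r_neq0 Z0))).
rewrite !mulr_sumr; apply: eq_bigr => tau _.
rewrite [RHS]mulrC; apply: chain_kernel_ratio => // v vL.
by rewrite !glue_out.
Qed.

(** Both sides of the DLR equation are measures in the conditioning event. They agree on deep
    cylinders outside L, where the kernel is constant, hence on the sigma-algebra. *)
Lemma chain_gibbs m (P : probability (config V) R) :
  (forall v, `|m v| <= 1) -> (forall v, satisfies_recursion m v) ->
  is_chain m P -> gibbs_state e o J beta P.
Proof.
move=> m1 mrec cP L sigma; split.
- by move=> B _; exact: kernel_coordinate_sigma.
- exact: kernel_integrable.
pose f := fun x : config V => (kernel sigma x)%:E.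
have mf := measurable_int _ (kernel_integrable P sigma).
have f0 x : (0 <= f x)%E.
  by rewrite lee_fin kernel_ge0.
pose nu := fun B : set (config V) => (\int[P]_(x in B) f x)%E.
have nu0 : nu set0 = 0%E by exact: integral_set0.
have nu_ge0 B : (0 <= nu B)%E by apply: integral_ge0 => x _; exact: f0.
have nu_add : semi_sigma_additive nu.
  exact: semi_sigma_additive_nng_induced mf f0.
pose nuM : {measure set (config V) -> \bar R} := HB.pack nu
  (isMeasure.Build _ _ _ nu nu0 nu_ge0 nu_add).
pose mu1 : {measure set (config V) -> \bar R} :=
  mrestr P (measurable_spin_event sigma).
have [k0 ck] := covers_exists e o L.
move=> B FB; rewrite setIC.
apply: (coordinate_sigma_measure_eq vtxK idxK (k0 := k0)
  (m1 := mu1) (m2 := nuM) _ _ FB).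
  by rewrite /= /mrestr setTI (le_lt_trans (probability_le1 _ _)) ?ltry//;
    exact: measurable_spin_event.
move=> k xi kk; rewrite /= /mrestr setIC (chain_cond_cyl _ _ m1 _ cP (ck k kk))//.
rewrite /nu (eq_integral (cst (kernel sigma xi)%:E)); last first.
  by move=> x /set_mem h; rewrite /f /= (kernel_loc sigma (ck k kk) h).
by rewrite integral_cst//; exact: (@cyl_measurable _ _ _ vtxK idxK (outside L) k xi).
Qed.

End ChainGibbs.

(** * Comparison of a Gibbs state with chains *)

Section Comparison.
Variables (R : realType) (V : choiceType) (e : rel V) (o : V).
Variables (J : V -> R) (beta : R).
Hypothesis Htree : is_tree e.
Hypothesis Hlocfin : locally_finite e.
Hypothesis Hinf : infinite_set [set: V].

Local Notation par := (parent e o).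
Local Notation vtx := (vertex e o).
Local Notation idx := (vindex e o).
Local Notation cyl := (cyl (vindex e o)).
Local Notation sp := (spin R).
Local Notation kernel := (gibbs_kernel e o J beta).
Local Notation is_chain := (is_chain e o J beta).
Local Notation satisfies_recursion := (satisfies_recursion e o J beta).

Let vtxK := vertexK o Htree Hlocfin Hinf.
Let idxK := vindexK o Htree Hlocfin Hinf.
Let mcyl K k xi : measurable (cyl K k xi : set (config V)).
Proof. exact: (@cyl_measurable _ _ _ vtxK idxK K k xi). Qed.

(* Fields equal to the spins outside L force the chain to follow the boundary
   condition there. *)
Lemma chain_outside m (P : probability (config V) R) (L : {fset V}) k eta :
  (forall v, v \notin L -> m v = sp (eta v)) -> is_chain m P ->
  P (~` cyl (outside L) k eta) = 0%E.
Proof.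
move=> mL cP; pose A : set (V -> bool) := ~` cyl (outside L) k eta.
have dA : determined idx setT k A.
  move=> x y nx h hy; apply: nx; apply: (cyl_trans hy).
  by apply: cyl_sym; apply: cyl_weaken h.
pose Q (B : set (config V)) := measurable B /\ P B = 0%E.
suff : Q A by case.
apply: (determined_ind vtxK idxK (P := Q) dA).
- by split => //; rewrite measure0.
- move=> xi nxi; split; first exact: mcyl.
  have [v [vL vk xv]] : exists v, [/\ v \notin L, (idx v < k)%N & xi v != eta v].
    apply: contrapT => h; apply: nxi => v /outsideP vL vk.
    by apply: contrapT => /eqP xe; apply: h; exists v.
  rewrite cP; congr EFin; apply/eqP; rewrite prodf_seq_eq0; apply/hasP.
  exists (Ordinal vk); first by rewrite mem_index_enum.
  rewrite /= idxK /chain_kernel mL//.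
  have -> : 1 + sp (xi v) * sp (eta v) = 0.
    by move: xv; case: (xi v); case: (eta v) => //= _; rewrite /spin; lra.
  by rewrite mulr0 mul0r.
- move=> B C [mB PB] [mC PC] BC0; split; first exact: measurableU.
  by rewrite measureU// [X in (X + _)%E]PB [X in (_ + X)%E]PC adde0.
Qed.

(** The chain gives full mass to the cylinder of eta outside L, so conditioning on this cylinder
    does not change it. *)
Lemma chain_spin_event m (P : probability (config V) R) (L : {fset V})
    (sigma : {ffun L -> bool}) eta :
  (forall v, `|m v| <= 1) -> (forall v, v \in L -> satisfies_recursion m v) ->
  (forall v, v \notin L -> m v = sp (eta v)) -> is_chain m P ->
  P (spin_event sigma) = (kernel sigma eta)%:E.
Proof.
move=> m1 mrec mL cP; have [k ck] := covers_exists e o L.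
have cLk := ck k (leqnn k).
pose C : set (config V) := cyl (outside L) k eta.
have mC : measurable C by exact: mcyl.
have mS := measurable_spin_event o Htree Hlocfin Hinf sigma.
have PnC : P (~` C) = 0%E by exact: chain_outside mL cP.
have PC : P C = 1%E.
  have := probability_setC P mC; rewrite PnC => /esym/eqP.
  by rewrite sube_eq ?add0e// ?fin_num_adde_defr// => /eqP <-.
have <- : P (spin_event sigma `&` C) = P (spin_event sigma).
  have mD : measurable (spin_event sigma `\` C) by exact: measurableD.
  have P0 : P (spin_event sigma `\` C) = 0%E.
    apply: (subset_measure0 mD (measurableC mC) _ PnC).
    by move=> x [].
  have := measureU P (measurableI _ _ mS mC) mD.
  rewrite setUIDK setDE setIACA setICr setI0 => ->//.
  by rewrite [X in (_ + X)%E]P0 adde0.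
have := chain_cond_cyl Htree Hlocfin Hinf sigma eta m1 mrec cP cLk.
by rewrite -/C PC mule1.
Qed.

Lemma measure_determined_spin_events (mu : {measure set (config V) -> \bar R})
    (L : {fset V}) k xi : (forall v, (idx v < k)%N -> v \in L) ->
  mu (cyl setT k xi) = (\sum_(sigma : {ffun L -> bool} |
    `[< cyl setT k xi (Defs.glue sigma xi) >]) mu (spin_event sigma))%E.
Proof.
move=> kL; rewrite (measure_spin_events o Htree Hlocfin Hinf mu L)//.
rewrite [RHS]big_mkcond /=; apply: eq_bigr => sigma _; case: asboolP => h.
  rewrite setIidl// => eta he v _ vk; rewrite -h//.
  exact: spin_event_eq he (spin_event_glue sigma xi) (kL v vk).
rewrite (_ : _ `&` _ = set0) ?measure0// -subset0 => eta [he hc].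
apply: h => v _ vk; rewrite -hc//.
exact: spin_event_eq (spin_event_glue sigma xi) he (kL v vk).
Qed.

(** A Gibbs state is an average over boundary conditions of finite-volume measures, each of which is
    a chain on L. An estimate uniform in the boundary condition therefore passes to the state. *)
Lemma gibbs_cyl_approx (mu : probability (config V) R) (L : {fset V}) k xi
    (c eps : R) :
  gibbs_state e o J beta mu -> (forall v, (idx v < k)%N -> v \in L) ->
  (forall eta : V -> bool, exists m : V -> R, [/\ forall v, `|m v| <= 1,
     forall v, v \in L -> satisfies_recursion m v,
     forall v, v \notin L -> m v = sp (eta v) &
     `|\prod_(i < k) chain_kernel e o J beta m (vtx i) xi - c| <= eps]) ->
  ((c - eps)%:E <= mu (cyl setT k xi) <= (c + eps)%:E)%E.
Proof.
move=> gmu kL H.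
pose S (sigma : {ffun L -> bool}) := `[< cyl setT k xi (Defs.glue sigma xi) >].
pose g (eta : config V) : R := \sum_(sigma : {ffun L -> bool} | S sigma) kernel sigma eta.
have gE eta : c - eps <= g eta <= c + eps.
  have [m [m1 mrec mL]] := H eta.
  have [P cP] := chain_measure_exists o J beta Htree Hlocfin Hinf m1.
  suff -> : \prod_(i < k) chain_kernel e o J beta m (vtx i) xi = g eta.
    by rewrite ler_distl.
  apply: EFin_inj; rewrite -cP (measure_determined_spin_events _ _ kL).
  rewrite /g -sumEFin; apply: eq_bigr => sigma _.
  exact: chain_spin_event mL cP.
pose F (sigma : {ffun L -> bool}) := fun eta : config V => (kernel sigma eta)%:E.
have Fint sigma : mu.-integrable setT (F sigma).
  exact: (kernel_integrable o J beta Htree Hlocfin Hinf mu sigma).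
pose G := fun eta : config V => (\sum_(sigma : {ffun L -> bool} | S sigma) F sigma eta)%E.
have Gint : mu.-integrable setT G by exact: integrable_sum.
have GE eta : G eta = (g eta)%:E by rewrite /G sumEFin.
have -> : mu (cyl setT k xi) = (\int[mu]_eta G eta)%E.
  rewrite (integral_sum _ Fint)// (measure_determined_spin_events _ _ kL).
  (* With the whole space as conditioning event, the DLR equation expresses the probability as the
     integral of the kernel. *)
  apply: eq_bigr => sigma _; have [_ _ gs] := gmu L sigma.
  have := gs setT (@measurableT _ (g_sigma_algebraType (coordinate_events _)));
  by rewrite setIT.
have cst_int (r : R) : (\int[mu]_(eta in [set: config V]) (cst r%:E) eta = r%:E)%E.
  by rewrite integral_cst//= probability_setT mule1.
have cst_integrable (r : R) : mu.-integrable setT (cst r%:E : config V -> \bar R).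
  exact: finite_measure_integrable_cst.
rewrite -{1}(cst_int (c - eps)) -(cst_int (c + eps)).
apply/andP; split; apply: le_integral => // eta _; rewrite GE lee_fin.
  by have /andP[] := gE eta.
by have /andP[] := gE eta.
Qed.

End Comparison.

(** * Spherically symmetric fields *)

(* tanh (n artanh t) as a rational function of t *)
Definition tanh_nmul (R : realType) (n : nat) (t : R) : R :=
  ((1 + t) ^+ n - (1 - t) ^+ n) / ((1 + t) ^+ n + (1 - t) ^+ n).

Lemma prodr_dist_le (R : realType) (n : nat) (a b : nat -> R) :
  (forall i, 0 <= a i <= 1) -> (forall i, 0 <= b i <= 1) ->
  `|\prod_(i < n) a i - \prod_(i < n) b i| <= \sum_(i < n) `|a i - b i|.
Proof.
move=> ha hb; elim: n => [|n IH]; first by rewrite !big_ord0 subrr normr0.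
rewrite !big_ord_recr /=.
set A := \prod_(i < n) a i in IH *; set B := \prod_(i < n) b i in IH *.
have -> : A * a n - B * b n = (A - B) * a n + B * (a n - b n) by ring.
have /andP[an0 an1] := ha n.
have B0 : 0 <= B by apply: prodr_ge0 => i _; have /andP[] := hb i.
have B1 : B <= 1 by apply: prodr_ile1 => i _; exact: hb.
apply: (le_trans (ler_normD _ _)); rewrite !normrM (ger0_norm an0) (ger0_norm B0).
apply: lerD; first by apply: le_trans IH; rewrite ler_piMr.
by rewrite ler_piMl.
Qed.

Lemma cross_factor_le (R : realType) (a t : R) : `|a| <= t -> t < 1 ->
  0 <= (1 + a) * (1 - t) <= (1 - a) * (1 + t).
Proof.
rewrite ler_norml => /andP[a1 a2] t1; apply/andP; split.
  by rewrite mulr_ge0//; lra.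
rewrite -subr_ge0 (_ : _ - _ = 2 * (t - a)); last by ring.
by rewrite mulr_ge0//; lra.
Qed.

(** The ratio is an odd increasing function of log (P / M), and the hypotheses place P / M between Y
    / X and X / Y. *)
Lemma norm_diff_ratio_le (R : realType) (P M X Y : R) :
  0 < P -> 0 < M -> 0 < X -> 0 < Y -> P * Y <= M * X -> M * Y <= P * X ->
  `|(P - M) / (P + M)| <= (X - Y) / (X + Y).
Proof.
move=> P0 M0 X0 Y0 h1 h2.
rewrite ler_norml; apply/andP; split.
  rewrite -subr_ge0 (_ : _ - _ = 2 * (P * X - M * Y) / ((X + Y) * (P + M))).
    by rewrite divr_ge0// mulr_ge0 ?subr_ge0// ltW// addr_gt0.
  by field; rewrite !gt_eqF ?addr_gt0.
rewrite -subr_ge0 (_ : _ - _ = 2 * (M * X - P * Y) / ((X + Y) * (P + M))).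
  by rewrite divr_ge0// mulr_ge0 ?subr_ge0// ltW// addr_gt0.
by field; rewrite !gt_eqF ?addr_gt0.
Qed.

Section Spherical.
Variables (R : realType) (V : choiceType) (e : rel V) (o : V).
Variables (J : V -> R) (beta : R).
Hypothesis Htree : is_tree e.
Hypothesis Hlocfin : locally_finite e.
Hypothesis Hinf : infinite_set [set: V].

Local Notation par := (parent e o).
Local Notation fch := (fchildren e o).
Local Notation vtx := (vertex e o).
Local Notation idx := (vindex e o).
Local Notation dist := (dist e o).
Local Notation cyl := (cyl (vindex e o)).
Local Notation sp := (spin R).
Local Notation th := (edge_theta o J beta).
Local Notation chain_kernel := (chain_kernel e o J beta).
Local Notation is_chain := (is_chain e o J beta).
Local Notation gibbs := (gibbs_state e o J beta).
Local Notation satisfies_recursion := (satisfies_recursion e o J beta).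

Let vtxK := vertexK o Htree Hlocfin Hinf.
Let idxK := vindexK o Htree Hlocfin Hinf.

(** The only value at v that makes Pp and Pm proportional to 1 + m_v and 1 - m_v, that is, the
    solution of the recursion at v. *)
Definition parent_field (m : V -> R) (v : V) : R :=
  let Pp := \prod_(w <- fch v) (1 + th w * m w) in
  let Pm := \prod_(w <- fch v) (1 - th w * m w) in (Pp - Pm) / (Pp + Pm).

Fixpoint field_from_leaves (eta : V -> bool) (n : nat) : V -> R :=
  if n is n'.+1 then parent_field (field_from_leaves eta n')
  else fun v => sp (eta v).

(* The field inside the ball of radius N with boundary condition eta; the
   truncated difference vanishes outside of the ball. *)
Definition boundary_field (eta : V -> bool) (N : nat) (v : V) : R :=
  field_from_leaves eta (N - dist v) v.

Let factor_gt0 (m : V -> R) v : (forall w, `|m w| <= 1) ->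
  0 < 1 + th v * m v /\ 0 < 1 - th v * m v.
Proof.
move=> m1; split; first exact: edge_factor_gt0.
by rewrite -mulrN edge_factor_gt0// normrN.
Qed.

Let prod_gt0 (m : V -> R) v : (forall w, `|m w| <= 1) ->
  0 < \prod_(w <- fch v) (1 + th w * m w) /\
  0 < \prod_(w <- fch v) (1 - th w * m w).
Proof.
by move=> m1; split; apply: prodr_gt0 => w _; have [] := factor_gt0 w m1.
Qed.

(** Agreement on the children suffices; this matters because [boundary_field] uses a different
    iterate of [field_from_leaves] on each level. *)
Lemma parent_field_recursion (m m' : V -> R) v : (forall w, `|m w| <= 1) ->
  (forall w, w \in fch v -> m' w = m w) -> m' v = parent_field m v ->
  satisfies_recursion m' v.
Proof.
move=> m1 mm m'v; have [Pp Pm] := prod_gt0 v m1.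
set P := \prod_(w <- fch v) (1 + th w * m w) in Pp.
set M := \prod_(w <- fch v) (1 - th w * m w) in Pm.
have PM : P + M != 0 by rewrite gt_eqF// addr_gt0.
exists ((P + M) / 2); first by rewrite divr_gt0// addr_gt0.
move=> b; rewrite m'v /parent_field -/P -/M.
have -> : \prod_(w <- fch v) (1 + th w * (sp b * m' w)) = if b then P else M.
  rewrite /P /M; case: b; rewrite big_seq [RHS]big_seq; apply: eq_bigr => w wv;
    by rewrite mm// /spin ?mul1r ?mulN1r ?mulrN.
by case: b; rewrite /spin; field.
Qed.

Lemma parent_field_le1 (m : V -> R) v : (forall w, `|m w| <= 1) -> `|parent_field m v| <= 1.
Proof.
move=> m1; have [Pp Pm] := prod_gt0 v m1.
rewrite /parent_field ler_norml ler_pdivlMr ?addr_gt0//.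
by rewrite ler_pdivrMr ?addr_gt0//; apply/andP; split; lra.
Qed.

Lemma field_from_leaves_le1 eta n v : `|field_from_leaves eta n v| <= 1.
Proof.
elim: n v => [|n IH] v /=; first by rewrite spin_norm.
exact: parent_field_le1.
Qed.

Lemma dist_child v w : w \in fch v -> dist w = (dist v).+1.
Proof.
rewrite in_fchildren// => /andP[/eqP wo /eqP <-].
exact: dist_parent.
Qed.

Lemma boundary_field_recursion eta N v : (dist v < N)%N ->
  satisfies_recursion (boundary_field eta N) v.
Proof.
move=> vN; apply: (@parent_field_recursion (field_from_leaves eta (N - (dist v).+1))).
- by move=> w; exact: field_from_leaves_le1.
- by move=> w /dist_child dw; rewrite /boundary_field dw.
rewrite /boundary_field; have -> : (N - dist v = (N - (dist v).+1).+1)%N by lia.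
by [].
Qed.

Variables (theta : nat -> R) (d : nat -> nat).
Hypothesis Htheta : forall v, v <> o -> th v = theta (dist v).
Hypothesis theta01 : forall i, (0 < i)%N -> 0 < theta i < 1.
Hypothesis Hd : forall v, size (fch v) = d (dist v).+1.

(** Each child multiplies Pp / Pm by a number between (1 - t) / (1 + t) and its inverse, so the
    extreme case has all children equal to t. *)
Lemma parent_field_bound (m : V -> R) v (t : R) : (forall w, `|m w| <= 1) -> 0 <= t < 1 ->
  (forall w, w \in fch v -> `|th w * m w| <= t) ->
  `|parent_field m v| <= tanh_nmul (d (dist v).+1) t.
Proof.
move=> m1 /andP[t0 t1] mt; have [Pp Pm] := prod_gt0 v m1.
rewrite /parent_field /tanh_nmul -Hd.
set P := \prod_(w <- fch v) (1 + th w * m w) in Pp *.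
set M := \prod_(w <- fch v) (1 - th w * m w) in Pm *.
set n := size _.
have pw (a : R) : a ^+ n = \prod_(w <- fch v) a.
  by rewrite big_const_seq count_predT iter_mulr_1.
have X0 : 0 < (1 + t) ^+ n by rewrite exprn_gt0; lra.
have Y0 : 0 < (1 - t) ^+ n by rewrite exprn_gt0; lra.
apply: norm_diff_ratio_le => //; rewrite !pw -!big_split /=;
  rewrite big_seq [leRHS]big_seq; apply: ler_prod => w wv.
  exact: (cross_factor_le (mt w wv) t1).
have nt : `|- (th w * m w)| <= t by rewrite normrN mt.
by have := cross_factor_le nt t1; rewrite opprK.
Qed.

(** The field at level i created by plus spins n levels below; it dominates the field of any other
    boundary condition at that distance. *)
Fixpoint mag (n i : nat) : R :=
  if n is n'.+1 then tanh_nmul (d i.+1) (theta i.+1 * mag n' i.+1) else 1.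

Lemma tanh_nmul_bounds n (t : R) : 0 <= t < 1 -> 0 <= tanh_nmul n t <= 1.
Proof.
move=> /andP[t0 t1]; rewrite /tanh_nmul.
have X0 : 0 < (1 + t) ^+ n by rewrite exprn_gt0; lra.
have Y0 : 0 < (1 - t) ^+ n by rewrite exprn_gt0; lra.
have XY : (1 - t) ^+ n <= (1 + t) ^+ n by apply: lerXn2r; rewrite ?nnegrE; lra.
by rewrite divr_ge0 ?ler_pdivrMr ?addr_gt0//=; lra.
Qed.

Lemma theta_mul01 i (x : R) : 0 <= x <= 1 -> 0 <= theta i.+1 * x < 1.
Proof.
move=> /andP[x0 x1]; have /andP[t0 t1] := @theta01 i.+1 isT.
by rewrite mulr_ge0 ?(ltW t0)//=; apply: le_lt_trans t1; rewrite ler_piMr// ltW.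
Qed.

Lemma mag_bounds n i : 0 <= mag n i <= 1.
Proof.
elim: n i => [|n IH] i /=; first by rewrite ler01 lexx.
exact/tanh_nmul_bounds/theta_mul01.
Qed.

Lemma field_from_leaves_mag eta n v :
  `|field_from_leaves eta n v| <= mag n (dist v).
Proof.
elim: n v => [|n IH] v /=; first by rewrite spin_norm.
apply: parent_field_bound.
- by move=> w; exact: field_from_leaves_le1.
- exact/theta_mul01/mag_bounds.
move=> w wv; have dw := dist_child wv.
have wo : w <> o by move: wv; rewrite in_fchildren// => /andP[/eqP].
have /andP[t0 _] := @theta01 (dist v).+1 isT.
by rewrite normrM Htheta// dw ger0_norm ?(ltW t0)// ler_wpM2l ?(ltW t0)// -dw.
Qed.

Lemma chain_kernel_le1 m v xi : (forall w, `|m w| <= 1) -> chain_kernel m v xi <= 1.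
Proof.
move=> m1; rewrite /chain_kernel.
have D0 : 0 < 1 + th v * (sp (xi (par v)) * m v) by rewrite edge_factor_gt0// spin_mul_le1.
have D1 : 0 <= 1 - th v * sp (xi (par v)).
  by rewrite -mulrN ltW// edge_factor_gt0// normrN spin_norm.
have D2 : 0 <= 1 + th v * sp (xi (par v)).
  by rewrite ltW// edge_factor_gt0// spin_norm.
have := m1 v; rewrite ler_norml => /andP[a1 a2].
rewrite ler_pdivrMr ?mulr_gt0// mul1r.
move: D0 D1 D2; set s := sp (xi (par v)); rewrite /spin.
case: (xi v) => D0 D1 D2; rewrite -subr_ge0.
  rewrite (_ : _ - _ = (1 - th v * s) * (1 - m v)); last by ring.
  by rewrite mulr_ge0// subr_ge0.
rewrite (_ : _ - _ = (1 + th v * s) * (1 + m v)); last by ring.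
by rewrite mulr_ge0// -lerBlDl sub0r.
Qed.

Lemma chain_kernel0_dist m v xi : (forall w, `|m w| <= 1) -> `|m v| <= 1 / 2 ->
  `|chain_kernel m v xi - chain_kernel (fun=> 0) v xi| <= 4 * `|m v|.
Proof.
move=> m1 m2; rewrite /chain_kernel.
set s := sp (xi (par v)); set s' := sp (xi v).
have t1 := edge_theta_lt1 o J beta v.
have s1 : `|s| = 1 by exact: spin_norm.
have s1' : `|s'| = 1 by exact: spin_norm.
have D0 : 0 < 1 + th v * (s * m v) by rewrite edge_factor_gt0// spin_mul_le1.
have D2 : 1 / 2 <= 1 + th v * (s * m v).
  have : `|th v * (s * m v)| <= 1 / 2.
    rewrite !normrM s1 [1 * `|m v|]mul1r; apply: (le_trans _ m2).
    by rewrite ler_piMl// ltW.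
  by rewrite ler_norml => /andP[h _]; lra.
(* The difference carries the factor m v. The other factors are at most 1, 2 and 2, the last because
   the denominator is at least 1/2; hence the constant 4. *)
have -> : (1 + th v * (s * s')) * (1 + s' * m v) / (2 * (1 + th v * (s * m v))) -
   (1 + th v * (s * s')) * (1 + s' * 0) / (2 * (1 + th v * (s * 0))) =
   (1 + th v * (s * s')) / 2 * ((s' - th v * s) * m v / (1 + th v * (s * m v))).
  by field; rewrite gt_eqF.
rewrite !normrM (normfV (1 + th v * (s * m v))) (gtr0_norm D0).
have h1 : `|1 + th v * (s * s')| <= 2.
  apply: (le_trans (ler_normD _ _)); rewrite normr1 !normrM s1 s1' !mulr1.
  by rewrite lerD2l// ltW.
have h2 : `|s' - th v * s| <= 2.
  apply: (le_trans (ler_normB _ _)); rewrite normrM s1 s1' mulr1.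
  by rewrite lerD2l// ltW.
have h3 : (1 + th v * (s * m v))^-1 <= 2.
  by rewrite invf_ple ?posrE//; lra.
rewrite (_ : 4 * `|m v| = 1 * (2 * `|m v| * 2)); last by ring.
apply: ler_pM => //.
- by rewrite mulr_ge0// ?mulr_ge0// invr_ge0 ltW.
- by rewrite normfV normr_nat ler_pdivrMr// mul1r.
apply: ler_pM => //.
  by rewrite invr_ge0 ltW.
by rewrite ler_wpM2r.
Qed.

(** When the extremal fields vanish in the limit, distant boundary conditions leave only small
    fields near the root, so every Gibbs state has the cylinder probabilities of the chain with zero
    field. *)
Lemma gibbs_cyl_free mu k xi :
  (forall i (eps : R), 0 < eps -> exists n0, forall n, (n0 <= n)%N -> mag n i <= eps) ->
  gibbs mu ->
  mu (cyl setT k xi) = (\prod_(i < k) chain_kernel (fun=> 0) (vtx i) xi)%:E.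
Proof.
move=> mag0 gmu; set c := \prod_(i < k) _.
suff H (eps : R) : 0 < eps -> eps <= 1 / 2 ->
    ((c - 4 * k%:R * eps)%:E <= mu (cyl setT k xi) <= (c + 4 * k%:R * eps)%:E)%E.
  have k0 : 0 < (4 * k%:R + 1 : R) by rewrite ltr_wpDl// mulr_ge0.
  apply/eqP; rewrite eq_le; apply/andP; split; apply/lee_addgt0Pr => x x0.
    (* The bound 1/2 is required by [chain_kernel0_dist]; the other term keeps the total error of
       the k factors below x. *)
    pose y := Num.min (1 / 2) (x / (4 * k%:R + 1)).
    have y0 : 0 < y by rewrite lt_min !divr_gt0.
    have y1 : y <= 1 / 2 by rewrite ge_min lexx.
    have y2 : y * (4 * k%:R + 1) <= x.
      by rewrite -ler_pdivlMr// ge_min lexx orbT.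
    have /andP[_] := H y y0 y1; move/le_trans; apply.
    by rewrite -EFinD lee_fin; lra.
  pose y := Num.min (1 / 2) (x / (4 * k%:R + 1)).
  have y0 : 0 < y by rewrite lt_min !divr_gt0.
  have y1 : y <= 1 / 2 by rewrite ge_min lexx.
  have y2 : y * (4 * k%:R + 1) <= x.
    by rewrite -ler_pdivlMr// ge_min lexx orbT.
  have /andP[+ _] := H y y0 y1; rewrite -(leeD2rE _ _ (_ : x%:E \is a fin_num))//.
  by apply: le_trans; rewrite -EFinD lee_fin; lra.
move=> eps0 eps1.
pose D := \max_(i < k) dist (vtx i).
have [n0 Hn0] : exists n0, forall n, (n0 <= n)%N -> forall i, (i <= D)%N -> mag n i <= eps.
  elim: D => [|D [n1 IH]].
    have [n0 h] := mag0 0%N eps eps0; exists n0 => n nn i.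
    by rewrite leqn0 => /eqP ->; exact: h.
  have [n0 h] := mag0 D.+1 eps eps0; exists (maxn n0 n1) => n nn i.
  rewrite leq_eqVlt => /orP[/eqP ->|iD].
    by apply: h; apply: leq_trans nn; exact: leq_maxl.
  by apply: IH => //; apply: leq_trans nn; exact: leq_maxr.
(* At this radius each of the first k vertices is at least n0 levels above the boundary. *)
pose N := (n0 + D.+1)%N.
pose L : {fset V} := [fset v in ballseq e o N]%fset.
have inL v : (v \in L) = (dist v < N)%N by rewrite inE mem_ballseq.
have vD v : (idx v < k)%N -> (dist v <= D)%N.
  by move=> vk; rewrite -(idxK v); exact: (leq_bigmax (Ordinal vk)).
apply: (gibbs_cyl_approx Htree Hlocfin Hinf gmu (L := L)).
  by move=> v /vD vd; rewrite inL /N addnS ltnS (leq_trans vd)// leq_addl.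
move=> eta; exists (boundary_field eta N).
have bf1 v : `|boundary_field eta N v| <= 1 by exact: field_from_leaves_le1.
split => //.
- by move=> v; rewrite inL; exact: boundary_field_recursion.
- move=> v; rewrite inL -leqNgt => vN; rewrite /boundary_field.
  by have /eqP -> : (N - dist v == 0)%N by rewrite subn_eq0.
have z1 : forall v : V, `|(fun=> 0 : R) v| <= 1 by move=> v; rewrite normr0.
apply: (le_trans (@prodr_dist_le _ k (fun i => chain_kernel (boundary_field eta N) (vtx i) xi)
   (fun i => chain_kernel (fun=> 0) (vtx i) xi) _ _)).
- by move=> i; apply/andP; split; [exact: chain_kernel_ge0|exact: chain_kernel_le1].
- move=> i; apply/andP; split; last exact: chain_kernel_le1 z1.
  exact: chain_kernel_ge0 (z1 _).
rewrite (_ : 4 * k%:R * eps = \sum_(i < k) 4 * eps); last first.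
  by rewrite sumr_const card_ord -mulr_natr; ring.
apply: ler_sum => i _.
have di : (dist (vtx i) <= D)%N by apply: vD; rewrite vtxK.
have be : `|boundary_field eta N (vtx i)| <= eps.
  apply: (le_trans (field_from_leaves_mag _ _ _)); apply: Hn0 => //.
  by rewrite leq_subRL /N; lia.
apply: (le_trans (chain_kernel0_dist _ _ _)) => //; first exact: le_trans be eps1.
by rewrite ler_wpM2l.
Qed.

Lemma gibbs_unique mu nu :
  (forall i (eps : R), 0 < eps -> exists n0, forall n, (n0 <= n)%N -> mag n i <= eps) ->
  gibbs mu -> gibbs nu ->
  forall A : set (config V), measurable A -> mu A = nu A.
Proof.
move=> mag0 gmu gnu A mA.
apply: (coordinate_sigma_measure_eq vtxK idxK (k0 := 0) (K := setT)) => //.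
  by rewrite (le_lt_trans (probability_le1 mu measurableT))// ltry.
move=> k xi _.
exact: etrans (gibbs_cyl_free k xi mag0 gmu) (esym (gibbs_cyl_free k xi mag0 gnu)).
Qed.

Lemma free_gibbs_exists :
  exists2 mu : probability (config V) R, gibbs mu & is_chain (fun=> 0) mu.
Proof.
have z1 : forall v : V, `|(fun=> 0 : R) v| <= 1 by move=> v; rewrite normr0.
have [P cP] := chain_measure_exists o J beta Htree Hlocfin Hinf z1.
exists P => //; apply: chain_gibbs cP => //.
move=> v; exists 1 => // b; rewrite mulr0 addr0 mul1r big1// => w _.
by rewrite !mulr0 addr0.
Qed.

(** The chain with field m and the chain with zero field are both Gibbs; the root is plus with
    probability (1 + m 0) / 2 under the first and 1/2 under the second. *)
Lemma multiple_gibbs (m : nat -> R) : (forall i, 0 <= m i <= 1) -> 0 < m 0%N ->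
  (forall i, m i = tanh_nmul (d i.+1) (theta i.+1 * m i.+1)) ->
  multiple_gibbs_states e o J beta.
Proof.
move=> m01 m0 mrec.
pose f v := m (dist v).
have f1 v : `|f v| <= 1.
  by have /andP[h0 h1] := m01 (dist v); rewrite ger0_norm.
have [P cP] := chain_measure_exists o J beta Htree Hlocfin Hinf f1.
have [Q gQ cQ] := free_gibbs_exists.
have gP : gibbs P.
  apply: chain_gibbs cP => // v.
  apply: (@parent_field_recursion f) => //.
  rewrite {1}/f mrec /parent_field /tanh_nmul -Hd.
  have E (g : R -> R) : g (theta (dist v).+1 * m (dist v).+1) ^+ size (fch v) =
     \prod_(w <- fch v) g (th w * f w).
    rewrite [RHS]big_seq (eq_bigr (fun=> g (theta (dist v).+1 * m (dist v).+1))).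
      by rewrite -big_seq big_const_seq count_predT iter_mulr_1.
    move=> w wv; have dw := dist_child wv.
    have wo : w <> o by move: wv; rewrite in_fchildren// => /andP[/eqP].
    by rewrite Htheta// /f dw.
  by rewrite (E (fun x => 1 + x)) (E (fun x => 1 - x)).
exists P, Q; split => //; exists (cyl setT 1 (fun=> true)).
  exact: (@cyl_measurable _ _ _ vtxK idxK).
rewrite cP cQ !big_ord_recl !big_ord0 !mulr1 /= (vertex0 o Htree Hlocfin Hinf) /chain_kernel.
have -> : th o = 0 by rewrite /edge_theta eqxx.
rewrite !mul0r !addr0 /spin !mul1r mulr1 /f (dist_self Htree) addr0.
by move=> [] h; lra.
Qed.

End Spherical.

(** * The map tanh (n artanh t) *)

Section TanhMultiple.
Variable R : realType.
Implicit Types (t T : R) (n : nat).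

Lemma tanh_nmul1 t : tanh_nmul 1 t = t.
Proof. by rewrite /tanh_nmul !expr1 (_ : 1 + t + (1 - t) = 2); [field|ring]. Qed.

(** The addition formula of tanh, on which the inductions on n below rest. *)
Lemma tanh_nmulS n t : 0 <= t < 1 ->
  tanh_nmul n.+1 t = (tanh_nmul n t + t) / (1 + tanh_nmul n t * t).
Proof.
move=> t01; have /andP[t0 t1] := t01.
rewrite /tanh_nmul !exprS.
have X0 : 0 < (1 + t) ^+ n by rewrite exprn_gt0; lra.
have Y0 : 0 < (1 - t) ^+ n by rewrite exprn_gt0; lra.
move: X0 Y0; set X := (1 + t) ^+ n; set Y := (1 - t) ^+ n => X0 Y0.
have h1 : (1 + t) * X + (1 - t) * Y != 0.
  by rewrite gt_eqF// ltr_pwDl// ?mulr_gt0// ?mulr_ge0//; lra.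
have h2 : X + Y != 0 by rewrite gt_eqF// addr_gt0.
field; rewrite h2 /=.
rewrite (_ : X + Y + (X - Y) * t = (1 + t) * X + (1 - t) * Y); last by ring.
by rewrite h1.
Qed.

Lemma tanh_nmul_ge n t : (0 < n)%N -> 0 < t < 1 -> t <= tanh_nmul n t < 1.
Proof.
case: n => // n _ /andP[t0 t1].
elim: n => [|n /andP[IH1 IH2]]; first by rewrite tanh_nmul1 lexx t1.
rewrite tanh_nmulS ?(ltW t0)//; set T := tanh_nmul n.+1 t in IH1 IH2 *.
have D : 0 < 1 + T * t by nra.
by rewrite ler_pdivlMr// ltr_pdivrMr// mul1r; apply/andP; split; nra.
Qed.

(* sinh (n u) >= n sinh u, written in terms of t = tanh u *)
Lemma tanh_nmul_lower n t : (0 < n)%N -> 0 < t < 1 ->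
  n%:R ^+ 2 * t ^+ 2 * (1 - tanh_nmul n t ^+ 2) <=
  tanh_nmul n t ^+ 2 * (1 - t ^+ 2).
Proof.
case: n => // n _ t01; have /andP[t0 t1] := t01.
elim: n => [|n IH]; first by rewrite tanh_nmul1; lra.
have /andP[T0 T1] := tanh_nmul_ge (ltn0Sn n) t01.
rewrite tanh_nmulS ?(ltW t0)// -[n.+2]addn1 natrD.
move: IH T0 T1; set T := tanh_nmul n.+1 t; set k : R := n.+1%:R => IH T0 T1.
have k0 : 0 <= k by exact: ler0n.
have D : 0 < 1 + T * t by nra.
have -> : 1 - ((T + t) / (1 + T * t)) ^+ 2 =
    (1 - T ^+ 2) * (1 - t ^+ 2) / (1 + T * t) ^+ 2.
  by field; rewrite gt_eqF.
have -> : ((T + t) / (1 + T * t)) ^+ 2 * (1 - t ^+ 2) =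
    (T + t) ^+ 2 * ((1 - t ^+ 2) / (1 + T * t) ^+ 2) by field; rewrite gt_eqF.
rewrite -[(1 - T ^+ 2) * _ / _]mulrA [leLHS]mulrA.
rewrite ler_wpM2r//; first by rewrite divr_ge0 ?sqr_ge0//; nra.
have u0 : 0 <= 1 - T ^+ 2 by nra.
have u1 : 1 - T ^+ 2 <= 1 by nra.
(* The goal has become (k + 1)^2 t^2 (1 - T^2) <= (T + t)^2. After expansion the square terms follow
   from the induction hypothesis and from T^2 >= 0; this bound gives the cross term. *)
have h : k * t * (1 - T ^+ 2) <= T.
  rewrite -(@ler_pXn2r _ 2)// ?nnegrE; last by lra.
    rewrite exprMn [(1 - T ^+ 2) ^+ 2]expr2 mulrA exprMn.
    apply: (@le_trans _ _ (T ^+ 2 * (1 - t ^+ 2) * (1 - T ^+ 2))).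
      by rewrite ler_wpM2r.
    have v1 : 1 - t ^+ 2 <= 1 by nra.
    have v0 : 0 <= 1 - t ^+ 2 by nra.
    by rewrite -mulrA ler_piMr ?sqr_ge0// mulr_ile1.
  by rewrite !mulr_ge0// ltW.
have hh : t * (k * t * (1 - T ^+ 2)) <= t * T by rewrite ler_wpM2l// ltW.
have h3 : t ^+ 2 * (1 - T ^+ 2) <= t ^+ 2 by rewrite ler_piMr// sqr_ge0.
have h4 : T ^+ 2 * (1 - t ^+ 2) <= T ^+ 2.
  by rewrite ler_piMr ?sqr_ge0//; nra.
by nra.
Qed.

(* The constant 1 / 7 is the margin that makes the induction close. *)
Lemma tanh_nmul_upper n t : (0 < n)%N -> 0 < t < 1 ->
  tanh_nmul n t ^+ 2 * (1 + 7^-1 * (n%:R ^+ 2 - 1) * t ^+ 2) <=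
  n%:R ^+ 2 * t ^+ 2.
Proof.
case: n => // n _ t01; have /andP[t0 t1] := t01.
elim: n => [|n IH]; first by rewrite tanh_nmul1; lra.
have /andP[T0 T1] := tanh_nmul_ge (ltn0Sn n) t01.
rewrite tanh_nmulS ?(ltW t0)// -[n.+2]addn1 natrD.
move: IH T0 T1; set T := tanh_nmul n.+1 t; set k : R := n.+1%:R => IH T0 T1.
have k1 : 1 <= k by rewrite /k ler1n.
set z := t ^+ 2 in IH *.
have z0 : 0 < z by rewrite exprn_gt0.
have z1 : z < 1 by rewrite exprn_ilt1 ?ltW.
(* With this q the induction hypothesis reads T q <= k t. *)
pose q := Num.sqrt (1 + 7^-1 * (k ^+ 2 - 1) * z).
have k2 : 0 <= k ^+ 2 - 1 by nra.
have Q0 : 0 <= 7^-1 * (k ^+ 2 - 1) * z by rewrite !mulr_ge0// ?ltW// invr_ge0.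
have qq : q ^+ 2 = 1 + 7^-1 * (k ^+ 2 - 1) * z by rewrite sqr_sqrtr// addr_ge0.
have q0 : 0 <= q by exact: sqrtr_ge0.
have q1 : 1 <= q by rewrite -(@ler_pXn2r _ 2) ?nnegrE// expr1n qq lerDl.
have qk : q <= k.
  rewrite -(@ler_pXn2r _ 2) ?nnegrE//.
  rewrite qq; have : (k ^+ 2 - 1) * z <= k ^+ 2 - 1 by rewrite ler_piMr// ltW.
  have : 0 <= (k ^+ 2 - 1) * z by rewrite mulr_ge0// ltW.
  by move: k2; lra.
have Tge0 : 0 <= T by lra.
have k0 : 0 <= k by lra.
have Tq : T * q <= k * t.
  rewrite -(@ler_pXn2r _ 2) ?nnegrE; [|by []|exact: mulr_ge0|by rewrite mulr_ge0// ltW].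
  by rewrite [(T * q) ^+ 2]exprMn [(k * t) ^+ 2]exprMn qq; exact: IH.
have D : 0 < 1 + T * t by nra.
(* The addition formula is increasing in T, and at the bound T = k t / q it equals (k + q) t / (q +
   k z). The inequality [key] is the claim for that value. *)
have key : (k + q) ^+ 2 * (q ^+ 2 + 7^-1 * (2 * k + 1) * z) <=
    (k + 1) ^+ 2 * (q + k * z) ^+ 2.
  pose m := (q - 1) / (k + 1).
  have kq : k + q = (k + 1) * (1 + m) by rewrite /m; field; lra.
  have m0 : 0 <= m by rewrite divr_ge0//; lra.
  have m1 : m <= 1 by rewrite ler_pdivrMr; lra.
  have mq : m * (q + 1) = 7^-1 * (k - 1) * z.
    rewrite /m; apply: (mulIf (x := k + 1)); first by lra.
    rewrite mulrAC divfK; last by lra.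
    have -> : (q - 1) * (q + 1) = q ^+ 2 - 1 by ring.
    by rewrite qq; ring.
  rewrite kq exprMn -[leLHS]mulrA ler_wpM2l ?sqr_ge0//.
  (* What remains is to bound (1 + m)^2 (q^2 + (2 k + 1) z / 7) by (q + k z)^2. The terms bounded by
     [a2] and [a5] contribute 2/7 and 12/7 of q k z, which add up to the coefficient 2 on the right;
     hence the constant 7. *)
  have a1 : q * m <= 7^-1 * (k * z).
    apply: (@le_trans _ _ (m * (q + 1))); first by nra.
    by rewrite mq; nra.
  have qm0 : 0 <= q * m by rewrite mulr_ge0.
  have kz0 : 0 <= k * z by rewrite mulr_ge0 ?ltW//; lra.
  have a2 : q * (q * m) <= q * (7^-1 * (k * z)) by rewrite ler_wpM2l.
  have a3 : (q * m) ^+ 2 <= (7^-1 * (k * z)) ^+ 2.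
    by rewrite ler_pXn2r// nnegrE; lra.
  have a4 : (1 + m) ^+ 2 <= 4 by nra.
  have a5 : (1 + m) ^+ 2 * (7^-1 * (2 * k + 1) * z) <= 4 * (7^-1 * (3 * k) * z).
    apply: ler_pM => //; first by rewrite sqr_ge0.
    - by rewrite !mulr_ge0// ?ltW//; lra.
    - by rewrite ler_wpM2r ?(ltW z0)//; lra.
  have a6 : k * z <= q * (k * z) by rewrite ler_peMl.
  have -> : (1 + m) ^+ 2 * (q ^+ 2 + 7^-1 * (2 * k + 1) * z) =
    q ^+ 2 + 2 * (q * (q * m)) + (q * m) ^+ 2 + (1 + m) ^+ 2 * (7^-1 * (2 * k + 1) * z) by ring.
  have -> : (q + k * z) ^+ 2 = q ^+ 2 + 2 * (q * (k * z)) + (k * z) ^+ 2 by ring.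
  have a7 : (7^-1 * (k * z)) ^+ 2 <= (k * z) ^+ 2.
    have s0 := sqr_ge0 (k * z).
    have -> : (7^-1 * (k * z)) ^+ 2 = 49^-1 * (k * z) ^+ 2 by field.
    by lra.
  by lra.
have TT : (T + t) * (q + k * z) <= (k + q) * t * (1 + T * t).
  have zt : z = t ^+ 2 by [].
  have : T * q * (1 - z) <= k * t * (1 - z) by apply: ler_wpM2r => //; rewrite subr_ge0 ltW.
  rewrite -subr_ge0 => h; rewrite -subr_ge0.
  by move: h; congr (_ <= _); rewrite zt; ring.
rewrite expr_div_n mulrAC ler_pdivrMr ?exprn_gt0//.
have qz : 0 < q + k * z by nra.
rewrite -(@ler_pM2r _ ((q + k * z) ^+ 2)) ?exprn_gt0//.
have -> : 1 + 7^-1 * ((k + 1) ^+ 2 - 1) * z = q ^+ 2 + 7^-1 * (2 * k + 1) * z.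
  by rewrite qq; ring.
set W := q ^+ 2 + _ in key *.
have W0 : 0 <= W by rewrite addr_ge0 ?sqr_ge0// !mulr_ge0 ?invr_ge0// ?ltW//; lra.
have TT2 : ((T + t) * (q + k * z)) ^+ 2 <= ((k + q) * t * (1 + T * t)) ^+ 2.
  by rewrite ler_pXn2r// nnegrE !mulr_ge0//; lra.
apply: (@le_trans _ _ (((k + q) * t * (1 + T * t)) ^+ 2 * W)).
  by rewrite mulrAC -exprMn ler_wpM2r.
rewrite 2!exprMn -/z.
have -> : (k + q) ^+ 2 * z * (1 + T * t) ^+ 2 * W =
  (k + q) ^+ 2 * W * (z * (1 + T * t) ^+ 2) by ring.
have -> : (k + 1) ^+ 2 * z * (1 + T * t) ^+ 2 * (q + k * z) ^+ 2 =
  (k + 1) ^+ 2 * (q + k * z) ^+ 2 * (z * (1 + T * t) ^+ 2) by ring.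
by rewrite ler_wpM2r// mulr_ge0 ?sqr_ge0// ltW.
Qed.

Lemma tanh_nmul_homo n (t t' : R) : 0 <= t -> t <= t' -> t' < 1 ->
  tanh_nmul n t <= tanh_nmul n t'.
Proof.
move=> t0 tt t1; rewrite /tanh_nmul.
have X0 : 0 < (1 + t) ^+ n by rewrite exprn_gt0; lra.
have Y0 : 0 < (1 - t) ^+ n by rewrite exprn_gt0; lra.
have X0' : 0 < (1 + t') ^+ n by rewrite exprn_gt0; lra.
have Y0' : 0 < (1 - t') ^+ n by rewrite exprn_gt0; lra.
have XX : (1 + t) ^+ n <= (1 + t') ^+ n by apply: lerXn2r; rewrite ?nnegrE; lra.
have YY : (1 - t') ^+ n <= (1 - t) ^+ n by apply: lerXn2r; rewrite ?nnegrE; lra.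
rewrite ler_pdivrMr ?addr_gt0// mulrAC ler_pdivlMr ?addr_gt0//.
by nra.
Qed.

Lemma tanh_nmul_continuous n (t : R) : 0 <= t < 1 ->
  {for t, continuous (@tanh_nmul R n)}.
Proof.
move=> /andP[t0 t1].
have X0 : 0 < (1 + t) ^+ n by rewrite exprn_gt0; lra.
have Y0 : 0 < (1 - t) ^+ n by rewrite exprn_gt0; lra.
have cX : {for t, continuous (fun x : R => (1 + x) ^+ n)}.
  apply: (@continuous_comp _ _ _ (fun x : R => 1 + x) (fun x => x ^+ n)).
    by apply: cvgD; [exact: cvg_cst|exact: cvg_id].
  exact: exprn_continuous.
have cY : {for t, continuous (fun x : R => (1 - x) ^+ n)}.
  apply: (@continuous_comp _ _ _ (fun x : R => 1 - x) (fun x => x ^+ n)).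
    by apply: cvgB; [exact: cvg_cst|exact: cvg_id].
  exact: exprn_continuous.
rewrite /tanh_nmul; apply: cvgM; first exact: cvgB.
by apply: cvgV; [rewrite gt_eqF// addr_gt0|exact: cvgD].
Qed.

End TanhMultiple.

(** * Growth of the inverse square field *)

Section MagRecursion.
Variables (R : realType) (theta : nat -> R) (d : nat -> nat) (delta : R).
Hypothesis theta01 : forall i, (0 < i)%N -> 0 < theta i < 1.
Hypothesis delta_gt0 : 0 < delta.
Hypothesis theta_delta : forall i, (0 < i)%N -> delta <= 1 - theta i ^+ 2.
Hypothesis d_gt0 : forall i, (0 < i)%N -> (0 < d i)%N.

Local Notation mag := (mag theta d).

Definition level_term (n : nat) : R :=
  \prod_(1 <= i < n.+1) ((d i)%:R * theta i) ^- 2.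

Let level_sum (n : nat) : R := \sum_(1 <= j < n.+1) level_term j.

Let factor i : R := ((d i.+1)%:R * theta i.+1) ^- 2.

(** The Horner form of the sum of the terms i + 1 to i + n of the series divided by its term i,
    which is what iterating the recursion up to level i produces. *)
Let tail_sum : nat -> nat -> R := fix tail n i :=
  if n is n'.+1 then factor i * (1 + tail n' i.+1) else 0.

Let th0 i : 0 < theta i.+1. Proof. by have /andP[] := @theta01 i.+1 isT. Qed.
Let th1 i : theta i.+1 < 1. Proof. by have /andP[] := @theta01 i.+1 isT. Qed.
Let dR i : 1 <= (d i.+1)%:R :> R. Proof. by rewrite ler1n d_gt0. Qed.
Let dR0 i : 0 < (d i.+1)%:R :> R. Proof. exact: lt_le_trans (dR i). Qed.

Lemma level_term_gt0 n : 0 < level_term n.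
Proof.
rewrite /level_term big_nat; apply: prodr_gt0 => -[//|i] _.
by rewrite invr_gt0 exprn_gt0// mulr_gt0.
Qed.

Let level_termS n : level_term n.+1 = level_term n * factor n.
Proof. by rewrite /level_term big_nat_recr. Qed.

Let factor_gt0 i : 0 < factor i.
Proof. by rewrite invr_gt0 exprn_gt0// mulr_gt0. Qed.

Let tail_sumE n i : level_term i * tail_sum n i =
  \sum_(i.+1 <= j < (i + n).+1) level_term j.
Proof.
elim: n i => [|n IH] i /=; first by rewrite mulr0 addn0 big_geq.
rewrite mulrA -level_termS mulrDr mulr1 IH big_nat_recl ?addnS ?ltnS ?leq_addr//.
rewrite addSn; congr (_ + _).
by rewrite [LHS]big_add1.
Qed.

Lemma level_sumE n : tail_sum n 0 = level_sum n.
Proof. by have := tail_sumE n 0; rewrite add0n /level_term big_geq// mul1r. Qed.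

Lemma mag_gt0_le1 n i : 0 < mag n i <= 1.
Proof.
elim: n i => [|n IH] i /=; first by rewrite ltr01 lexx.
have /andP[m0 m1] := IH i.+1.
have t01 : 0 < theta i.+1 * mag n i.+1 < 1.
  rewrite mulr_gt0//=; apply: le_lt_trans (th1 i).
  by rewrite ler_piMr// ltW.
have /andP[h1 h2] := tanh_nmul_ge (d_gt0 (ltn0Sn i)) t01.
have /andP[t0 _] := t01.
by rewrite (lt_le_trans t0 h1) ltW.
Qed.

Let arg01 n i : 0 < theta i.+1 * mag n i.+1 < 1.
Proof.
have /andP[m0 m1] := mag_gt0_le1 n i.+1.
rewrite mulr_gt0//=; apply: le_lt_trans (th1 i).
by rewrite ler_piMr// ltW.
Qed.

Lemma mag_ge_theta n i : theta i.+1 * mag n i.+1 <= mag n.+1 i.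
Proof. by have /andP[] := tanh_nmul_ge (d_gt0 (ltn0Sn i)) (arg01 n i). Qed.

(** The hypothesis is divided by D^2 (th x)^2 T^2, after its right side is enlarged to T^2. *)
Lemma inv_sqr_step_le (D th x T : R) : 0 < D -> 0 < th -> 0 < x -> 0 < T ->
  D ^+ 2 * (th * x) ^+ 2 * (1 - T ^+ 2) <= T ^+ 2 * (1 - (th * x) ^+ 2) ->
  T ^- 2 - 1 <= (D * th) ^- 2 * (x ^- 2).
Proof.
move=> D0 h0 x0 T0 H.
have p0 : 0 < D ^+ 2 * (th * x) ^+ 2 * T ^+ 2.
  by rewrite !mulr_gt0 ?exprn_gt0 ?mulr_gt0.
have -> : T ^- 2 - 1 = (D ^+ 2 * (th * x) ^+ 2 * (1 - T ^+ 2)) /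
    (D ^+ 2 * (th * x) ^+ 2 * T ^+ 2).
  by field; rewrite !gt_eqF.
have -> : (D * th) ^- 2 * (x ^- 2) = T ^+ 2 / (D ^+ 2 * (th * x) ^+ 2 * T ^+ 2).
  by field; rewrite !gt_eqF.
rewrite ler_pM2r ?invr_gt0//; apply: (le_trans H).
by rewrite ler_piMr ?sqr_ge0// gerBl sqr_ge0.
Qed.

Lemma inv_sqr_step_ge (c D th x T : R) : 0 < D -> 0 < th -> 0 < x -> 0 < T ->
  T ^+ 2 * (1 + c * (D ^+ 2 - 1) * (th * x) ^+ 2) <= D ^+ 2 * (th * x) ^+ 2 ->
  (D * th) ^- 2 * (x ^- 2 - c * th ^+ 2) <= T ^- 2 - c.
Proof.
move=> D0 h0 x0 T0 H.
have p0 : 0 < D ^+ 2 * (th * x) ^+ 2 * T ^+ 2.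
  by rewrite !mulr_gt0 ?exprn_gt0 ?mulr_gt0.
have -> : (D * th) ^- 2 * (x ^- 2 - c * th ^+ 2) =
    (T ^+ 2 * (1 - c * (th * x) ^+ 2)) / (D ^+ 2 * (th * x) ^+ 2 * T ^+ 2).
  by field; rewrite !gt_eqF.
have -> : T ^- 2 - c = (D ^+ 2 * (th * x) ^+ 2 * (1 - c * T ^+ 2)) /
    (D ^+ 2 * (th * x) ^+ 2 * T ^+ 2).
  by field; rewrite !gt_eqF.
rewrite ler_pM2r ?invr_gt0// -subr_ge0; move: H; rewrite -subr_ge0.
by congr (_ <= _); ring.
Qed.

Lemma mag_inv_sqr_le n i : mag n i ^- 2 - 1 <= tail_sum n i.
Proof.
elim: n i => [|n IH] i /=; first by rewrite expr1n invr1 subrr.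
have /andP[m0 _] := mag_gt0_le1 n i.+1.
have /andP[M0 _] := mag_gt0_le1 n.+1 i.
apply: (le_trans (inv_sqr_step_le (dR0 i) (th0 i) m0 M0
  (tanh_nmul_lower (d_gt0 (ltn0Sn i)) (arg01 n i)))).
by apply: ler_wpM2l; [exact: (ltW (factor_gt0 i))|rewrite -lerBlDl].
Qed.

(** The constants 1/7 and theta^2 / 7 on the two sides of a step differ by at least delta / 7, which
    supplies the new term of the sum. *)
Lemma mag_inv_sqr_ge n i : 7^-1 * delta * tail_sum n i <= mag n i ^- 2 - 7^-1.
Proof.
elim: n i => [|n IH] i /=; first by rewrite mulr0 expr1n invr1; lra.
have /andP[m0 _] := mag_gt0_le1 n i.+1.
have /andP[M0 _] := mag_gt0_le1 n.+1 i.
have H := tanh_nmul_upper (d_gt0 (ltn0Sn i)) (arg01 n i).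
apply: le_trans (inv_sqr_step_ge (dR0 i) (th0 i) m0 M0 H).
rewrite mulrCA; apply: ler_wpM2l; first exact: (ltW (factor_gt0 i)).
have dl := theta_delta (ltn0Sn i); have IHi := IH i.+1.
move: dl IHi; set a := theta _ ^+ 2; set b := mag _ _ ^- 2; set s := tail_sum _ _.
move=> dl IHi; rewrite mulrDr mulr1; lra.
Qed.

Lemma mag0_ge (S : R) n : level_sum n <= S -> (1 + S)^-1 <= mag n 0 ^+ 2.
Proof.
move=> hS; have := mag_inv_sqr_le n 0; rewrite level_sumE => h.
have /andP[m0 _] := mag_gt0_le1 n 0.
have p0 : 0 < mag n 0 ^+ 2 by rewrite exprn_gt0.
rewrite invf_ple ?posrE//; first by lra.
by apply: lt_le_trans (_ : mag n 0 ^- 2 <= _); [rewrite invr_gt0|lra].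
Qed.

Lemma mag0_le n : mag n 0 ^+ 2 * (7^-1 * delta * level_sum n) <= 1.
Proof.
have := mag_inv_sqr_ge n 0; rewrite level_sumE => h.
have /andP[m0 _] := mag_gt0_le1 n 0.
have p0 : 0 < mag n 0 ^+ 2 by rewrite exprn_gt0.
rewrite -ler_pdivlMl// mulr1; lra.
Qed.

(** One step up reduces the field at most by the factor theta, so smallness at the root forces
    smallness at each fixed level. *)
Lemma mag_shift n i : mag n i * \prod_(1 <= j < i.+1) theta j <= mag (i + n) 0.
Proof.
elim: i n => [|i IH] n; first by rewrite big_geq// mulr1.
rewrite addSnnS big_nat_recr//; apply: le_trans (IH n.+1).
rewrite mulrCA mulrC; apply: ler_wpM2r; last by rewrite mulrC mag_ge_theta.
rewrite big_nat; apply: prodr_ge0 => -[//|j] _; exact/ltW/th0.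
Qed.

Lemma mag_cvg0 : (forall M : R, exists n, M <= level_sum n) ->
  forall i (eps : R), 0 < eps -> exists n0, forall n, (n0 <= n)%N -> mag n i <= eps.
Proof.
move=> unb i eps eps0.
pose p := \prod_(1 <= j < i.+1) theta j.
have p0 : 0 < p.
  by rewrite /p big_nat; apply: prodr_gt0 => -[//|j] _; exact: th0.
have ep0 : 0 < eps * p by rewrite mulr_gt0.
(* The threshold makes the root field at most eps p, where p is the largest loss between level i and
   the root. *)
have [n0 hn0] := unb ((7^-1 * delta)^-1 * (eps * p) ^- 2).
exists n0 => n nn; rewrite -(ler_pM2r p0).
apply: (le_trans (mag_shift n i)).
have /andP[m0 _] := mag_gt0_le1 (i + n) 0.
rewrite -(@ler_pXn2r _ 2)// ?nnegrE; [|exact: ltW|exact: ltW].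
have c0 : 0 < 7^-1 * delta by rewrite mulr_gt0// invr_gt0.
have h1 : (eps * p) ^- 2 <= 7^-1 * delta * level_sum (i + n).
  rewrite -ler_pdivrMl//; apply: (le_trans hn0).
  rewrite /level_sum [leRHS](@big_cat_nat _ _ _ n0.+1)//=; last first.
    by rewrite ltnS (leq_trans nn)// leq_addl.
  by rewrite lerDl; apply: sumr_ge0 => j _; exact/ltW/level_term_gt0.
have := mag0_le (i + n); rewrite -ler_pdivlMr; last first.
  by apply: lt_le_trans h1; rewrite invr_gt0 exprn_gt0.
move=> /le_trans; apply; rewrite div1r invf_ple ?posrE ?exprn_gt0//.
by apply: lt_le_trans h1; rewrite invr_gt0 exprn_gt0.
Qed.

(** The recursion is increasing and starts from 1, the largest possible value. *)
Lemma mag_nonincreasing i : nonincreasing_seq (mag ^~ i).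
Proof.
apply/nonincreasing_seqP => n; elim: n i => [|n IH] i.
  by have /andP[] := mag_gt0_le1 1 i.
rewrite [leLHS]/= [leRHS]/=.
have /andP[a0 _] := arg01 n.+1 i; have /andP[_ b1] := arg01 n i.
apply: tanh_nmul_homo b1; first exact: ltW.
by apply: ler_wpM2l; [exact: (ltW (th0 i))|exact: IH].
Qed.

(** The fields decrease to limits, the recursion passes to the limit by continuity, and [mag0_ge]
    keeps the limit at the root positive. *)
Lemma mag_limit (S : R) : (forall n, level_sum n <= S) -> exists m : nat -> R,
  [/\ forall i, 0 <= m i <= 1, 0 < m 0%N &
      forall i, m i = tanh_nmul (d i.+1) (theta i.+1 * m i.+1)].
Proof.
move=> hS; pose m i := limn (mag ^~ i).
have cm i : mag ^~ i @ \oo --> m i.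
  apply: nonincreasing_is_cvgn; first exact: mag_nonincreasing.
  by exists 0 => _ [n _ <-]; have /andP[/ltW] := mag_gt0_le1 n i.
have m01 i : 0 <= m i <= 1.
  apply/andP; split.
    by apply: limr_ge; [exact: cm|apply: nearW => n; have /andP[/ltW] := mag_gt0_le1 n i].
  by apply: limr_le; [exact: cm|apply: nearW => n; have /andP[] := mag_gt0_le1 n i].
have S0 : 0 <= S by apply: le_trans (hS 0%N); rewrite /level_sum big_geq.
exists m; split => //.
  have h : (1 + S)^-1 <= m 0%N.
    apply: limr_ge; first exact: cm.
    apply: nearW => n; apply: (le_trans (mag0_ge (hS n))).
    have /andP[m0 m1] := mag_gt0_le1 n 0.
    by rewrite expr2 ler_piMr// ltW.
  by apply: lt_le_trans h; rewrite invr_gt0 ltr_wpDr.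
move=> i; have /andP[mi0 mi1] := m01 i.+1.
have t01 : 0 <= theta i.+1 * m i.+1 < 1.
  rewrite mulr_ge0 ?(ltW (th0 i))//=; apply: le_lt_trans (th1 i).
  by rewrite ler_piMr// ltW.
have c1 : (theta i.+1 * mag n i.+1) @[n --> \oo] --> theta i.+1 * m i.+1.
  by apply: cvgM; [exact: cvg_cst|exact: cm].
have c2 : tanh_nmul (d i.+1) (theta i.+1 * mag n i.+1) @[n --> \oo] -->
    tanh_nmul (d i.+1) (theta i.+1 * m i.+1).
  by apply: continuous_cvg; [exact: tanh_nmul_continuous|exact: c1].
have c3 : (mag n.+1 i) @[n --> \oo] --> m i.
  by have := cm i; rewrite -(cvg_shiftS (mag ^~ i)).
by apply: cvg_unique c3 c2.
Qed.

End MagRecursion.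

(** * The series *)

Lemma nneseries_ltyP (R : realType) (u : nat -> R) : (forall n, 0 <= u n) ->
  (\sum_(1 <= n <oo) (u n)%:E < +oo)%E <->
  exists M, forall n, \sum_(1 <= j < n.+1) u j <= M.
Proof.
move=> u0.
have u0' n : (1 <= n)%N -> true -> (0 <= (u n)%:E)%E by rewrite lee_fin.
split=> [foo|[M hM]].
  exists (fine (\sum_(1 <= n <oo) (u n)%:E)%E) => n.
  have h := nneseries_lim_ge n.+1 u0'.
  rewrite sumEFin in h; rewrite -lee_fin fineK//.
  rewrite ge0_fin_numE//; exact: nneseries_ge0.
apply: (@le_lt_trans _ _ M%:E); last exact: ltry.
apply: lime_le; first exact: is_cvg_nneseries.
apply: nearW => -[|n]; rewrite sumEFin lee_fin; last exact: hM.
by rewrite big_geq//; apply: le_trans (hM 0%N); rewrite big_geq.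
Qed.

Lemma tanh_gt0 (R : realType) (x : R) : 0 < x -> 0 < tanh x.
Proof.
move=> x0; rewrite /tanh; apply: divr_gt0; last by rewrite addr_gt0 ?expR_gt0.
by rewrite subr_gt0 ltr_expR; lra.
Qed.

(** Here 1 - tanh^2 is the inverse square of cosh, and cosh x <= exp x for x >= 0. The upper bound
    on J thus keeps theta uniformly away from 1. *)
Lemma tanh_sqr_gap (R : realType) (x y : R) : 0 <= x -> x <= y ->
  expR (- (2 * y)) <= 1 - tanh x ^+ 2.
Proof.
move=> x0 xy; apply: (@le_trans _ _ (expR (- (2 * x)))).
  by rewrite ler_expR lerN2 ler_pM2l.
have -> : expR (- (2 * x)) = expR (- x) ^+ 2.
  by rewrite -expRM_natl; congr expR; rewrite mulrN.
rewrite expRN /tanh expRN; set a := expR x.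
have a1 : 1 <= a by rewrite /a -expR0 ler_expR.
have a0 : 0 < a by exact: lt_le_trans a1.
have b0 : 0 < a ^+ 2 + 1 by rewrite addr_gt0// exprn_gt0.
have -> : (a - a^-1) / (a + a^-1) = (a ^+ 2 - 1) / (a ^+ 2 + 1).
  by field; rewrite !gt_eqF.
have -> : 1 - ((a ^+ 2 - 1) / (a ^+ 2 + 1)) ^+ 2 = 4 * a ^+ 2 / (a ^+ 2 + 1) ^+ 2.
  by field; rewrite gt_eqF.
rewrite exprVn ler_pdivlMr ?exprn_gt0// mulrC ler_pdivrMr ?exprn_gt0//.
have a2 : 1 <= a ^+ 2 by rewrite expr_ge1// ltW.
have -> : 4 * a ^+ 2 * a ^+ 2 = (2 * a ^+ 2) ^+ 2 by ring.
by rewrite ler_pXn2r ?nnegrE ?mulr_ge0 ?sqr_ge0//; lra.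
Qed.

(** * Sums of the powers n^(-2 alpha) *)

Section PowerSums.
Variables (R : realType) (alpha : R).

Let g (n : nat) : R := (n%:R `^ alpha) ^- 2.

Let g_ge0 n : 0 <= g n. Proof. by rewrite invr_ge0 sqr_ge0. Qed.

Lemma power_sum_unbounded M : alpha <= 1 / 2 ->
  exists n, M < \sum_(1 <= j < n.+1) g j.
Proof.
(* Since 2 alpha <= 1, bounded partial sums would make the harmonic series converge. *)
move=> al; apply: contrapT => /forallNP h.
apply: (@dvg_harmonic R); apply: nondecreasing_is_cvgn.
  apply/nondecreasing_seqP => n; rewrite /series /= big_nat_recr//= lerDl.
  by rewrite invr_ge0.
exists M => _ [n _ <-]; have /negP := h n; rewrite -leNgt; apply: le_trans.
rewrite /series /= big_add1 /=.
rewrite big_nat [leRHS]big_nat; apply: ler_sum => i _.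
rewrite /g lef_pV2 ?posrE ?exprn_gt0 ?powR_gt0//.
rewrite -powR_mulrn ?powR_ge0// -powRrM -[leRHS]powRr1//.
apply: ler_powR; first by rewrite ler1n.
by move: al; lra.
Qed.

Lemma power_sum_bounded : 1 / 2 < alpha ->
  exists M, forall n, \sum_(1 <= j < n.+1) g j <= M.
Proof.
(* The ratio r is 2^(1 - 2 alpha), which is less than 1 exactly when alpha > 1/2. *)
move=> al; pose r : R := 2 * (2 `^ alpha) ^- 2.
have a0 : 0 < alpha by apply: lt_trans al.
have p0 : 0 < (2 : R) `^ alpha by rewrite powR_gt0.
have r0 : 0 <= r by rewrite mulr_ge0// invr_ge0 sqr_ge0.
have r1 : r < 1.
  rewrite /r ltr_pdivrMr ?exprn_gt0// mul1r -powR_mulrn ?powR_ge0// -powRrM.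
  rewrite -[ltLHS]powRr1// /powR gt_eqF// ltr_expR ltr_pM2r ?ln_gt0 ?ltr1n//.
  by move: al; lra.
have g_anti m n : (0 < m)%N -> (m <= n)%N -> g n <= g m.
  move=> m0 mn; rewrite /g lef_pV2 ?posrE ?exprn_gt0 ?powR_gt0 ?ltr0n//; last first.
    exact: leq_trans mn.
  rewrite ler_pXn2r ?nnegrE ?powR_ge0//.
  by apply: ge0_ler_powR; rewrite ?nnegrE ?ler0n ?ler_nat// ltW.
have gpow k : (2 ^ k)%:R * g (2 ^ k) = r ^+ k.
  rewrite /g /r natrX exprMn exprVn -!exprM mulnC exprM; congr (_ * (_ ^+ 2)^-1).
  by rewrite -[in LHS]powR_mulrn// powRAC powR_mulrn// powR_ge0.
(* Cauchy condensation: the block from 2^k to 2^(k+1) has 2^k terms, each at most [g (2 ^ k)]. *)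
have dyadic k : \sum_(1 <= j < 2 ^ k) g j <= \sum_(j < k) r ^+ j.
  elim: k => [|k IH]; first by rewrite big_geq ?big_ord0.
  rewrite big_ord_recr /= (@big_cat_nat _ _ _ (2 ^ k)) ?expn_gt0 ?leq_exp2l//=.
  apply: lerD => //; rewrite -gpow.
  apply: (@le_trans _ _ (\sum_(2 ^ k <= j < 2 ^ k.+1) g (2 ^ k)%N)).
    rewrite big_nat [leRHS]big_nat; apply: ler_sum => j /andP[kj _].
    by apply: g_anti; rewrite ?expn_gt0.
  by rewrite sumr_const_nat expnS mul2n -addnn addnK mulr_natl.
exists (1 - r)^-1 => n.
apply: (@le_trans _ _ (\sum_(1 <= j < 2 ^ n.+1) g j)).
  have n2 : (n.+1 <= 2 ^ n.+1)%N by exact/ltnW/ltn_expl.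
  rewrite [leRHS](@big_cat_nat _ _ _ n.+1)//= lerDl.
  exact: sumr_ge0.
apply: (le_trans (dyadic _)).
have r1' : 0 < 1 - r by rewrite subr_gt0.
rewrite -(@ler_pM2l _ (1 - r))// mulfV ?gt_eqF//.
have -> : (1 - r) * \sum_(j < n.+1) r ^+ j = 1 - r ^+ n.+1.
  by have := subrX1 r n.+1 => h; rewrite -[LHS]opprK -mulNr opprB -h opprB.
by rewrite gerBl exprn_ge0.
Qed.

End PowerSums.

(** * The dichotomy *)

Lemma inv_sqr_le (R : realFieldType) (x y : R) :
  0 < x -> x <= y -> y ^- 2 <= x ^- 2.
Proof.
move=> x0 xy; have y0 : 0 < y by exact: lt_le_trans xy.
by rewrite lef_pV2 ?posrE ?exprn_gt0// ler_pXn2r// nnegrE ltW.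
Qed.

(** * Level sizes of a spherically symmetric tree *)

Section LevelSize.
Variables (V : choiceType) (e : rel V) (o : V).
Hypothesis Htree : is_tree e.
Hypothesis Hlocfin : locally_finite e.
Hypothesis Hinf : infinite_set [set: V].
Variable d : nat -> nat.
Hypothesis Hd : spherically_symmetric_with e o d.

Lemma size_fchildren v : size (fchildren e o v) = d (dist e o v).+1.
Proof. exact: (Hd (ltn0Sn _)). Qed.

(** The vertices of the lower level are counted according to their parents. *)
Lemma size_levelS n :
  #|` fset_set (level e o n.+1)| = (#|` fset_set (level e o n)| * d n.+1)%N.
Proof.
set A := fset_set (level e o n); set B := fset_set (level e o n.+1).
have sum1 (s : seq V) : size s = (\sum_(w <- s) 1)%N by rewrite sum1_size.
have AB w : w \in B -> parent e o w \in A.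
  rewrite !in_flevel// => /eqP dw; have wo : w <> o.
    by move=> wo; move: dw; rewrite wo (dist_self Htree).
  by move: dw; rewrite (dist_parent Htree wo) => -[->].
transitivity (\sum_(v <- A) \sum_(w <- B | parent e o w == v) 1)%N.
  rewrite [LHS](sum1 B) (exchange_big_dep xpredT)//=.
  rewrite big_seq [RHS]big_seq; apply: eq_bigr => w /AB pA.
  by rewrite [RHS]big_mkcond (bigD1_seq (parent e o w)) ?fset_uniq//= eqxx big1 ?addn0//;
    move=> v; rewrite eq_sym => /negbTE ->.
transitivity (\sum_(v <- A) d n.+1)%N; last first.
  by rewrite big_const_seq count_predT iter_addn_0 mulnC.
rewrite big_seq [RHS]big_seq; apply: eq_bigr => v; rewrite in_flevel// => /eqP dv.
rewrite sum1_count -size_filter -dv -size_fchildren; apply: perm_size.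
apply: uniq_perm; rewrite ?filter_uniq ?fset_uniq// => w.
rewrite mem_filter in_flevel// in_fchildren//.
have [wo|/eqP wo] := eqVneq w o; last first.
  rewrite (dist_parent Htree wo); case: eqP => //= ->.
  by rewrite dv eqxx.
by rewrite wo (dist_self Htree) andbF.
Qed.

Lemma size_level n :
  #|` fset_set (level e o n)| = (\prod_(1 <= i < n.+1) d i)%N.
Proof.
elim: n => [|n IH]; last by rewrite size_levelS IH [RHS]big_nat_recr.
rewrite big_geq// (_ : level e o 0 = [set o]).
  by rewrite fset_set1 cardfs1.
apply/seteqP; split => v; first exact: dist_eq0.
by move=> ->; exact: dist_self.
Qed.

Lemma branching_gt0 i : (0 < i)%N -> (0 < d i)%N.
Proof.
case: i => // n _; have [w dw] := level_nonempty o Htree Hlocfin Hinf n.+1.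
rewrite lt0n; apply/eqP => d0; have := size_levelS n; rewrite d0 muln0.
move=> /eqP; rewrite cardfs_eq0 => /eqP h.
by have := in_flevel o Htree Hlocfin n.+1 w; rewrite h dw eqxx in_fset0.
Qed.

End LevelSize.

(** * Multiplicity, uniqueness and boundedness of the partial sums *)

Section Dichotomy.
Variables (R : realType) (V : choiceType) (e : rel V) (o : V).
Variables (J : V -> R) (Jmin Jmax beta : R).
Hypothesis Htree : is_tree e.
Hypothesis Hinf : infinite_set [set: V].
Hypothesis Hlocfin : locally_finite e.
Hypothesis HJmin : 0 < Jmin.
Hypothesis HJ : forall v : V, v <> o -> Jmin <= J v <= Jmax.
Hypothesis Hbeta : 0 < beta.
Variables (theta : nat -> R) (d : nat -> nat).
Hypothesis Htheta : forall v : V, v <> o -> tanh (beta * J v) = theta (dist e o v).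
Hypothesis Hd : spherically_symmetric_with e o d.

(** Every positive level contains a vertex, so bounds on the interactions carry over to the sequence
    theta. *)
Let theta_vertex i : (0 < i)%N -> exists2 v, v <> o & theta i = tanh (beta * J v).
Proof.
move=> i0; have [v dv] := level_nonempty o Htree Hlocfin Hinf i.
have vo : v <> o.
  by move=> vo; move: dv i0; rewrite /level /= vo (dist_self Htree) => <-.
by exists v => //; rewrite Htheta//; congr theta; rewrite dv.
Qed.

Let bJ v : v <> o -> 0 < beta * J v <= beta * Jmax.
Proof.
move=> vo; have /andP[j1 j2] := HJ vo.
by rewrite ler_pM2l// j2 mulr_gt0// (lt_le_trans HJmin).
Qed.

Let theta01 i : (0 < i)%N -> 0 < theta i < 1.
Proof.
move=> /theta_vertex[v vo ->]; have /andP[b0 _] := bJ vo.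
rewrite tanh_gt0//=; have := tanh_lt1 (beta * J v).
by rewrite ltr_norml => /andP[].
Qed.

Let theta_gap i : (0 < i)%N -> expR (- (2 * (beta * Jmax))) <= 1 - theta i ^+ 2.
Proof.
move=> /theta_vertex[v vo ->]; have /andP[b0 b1] := bJ vo.
by apply: tanh_sqr_gap b1; exact: ltW.
Qed.

Let Hth v : v <> o -> edge_theta o J beta v = theta (dist e o v).
Proof. by move=> vo; rewrite /edge_theta -Htheta//; case: eqP. Qed.

Let d_gt0 := branching_gt0 Htree Hlocfin Hinf Hd.

Lemma multiple_gibbs_iff : multiple_gibbs_states e o J beta <->
  exists M, forall n, \sum_(1 <= j < n.+1) level_term theta d j <= M.
Proof.
split=> [[mu [nu [gmu gnu [A mA neq]]]]|[M hM]].
  apply: contrapT => unb; apply: neq.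
  apply: (gibbs_unique Htree Hlocfin Hinf Hth theta01 (size_fchildren Hd)) => //.
  apply: (mag_cvg0 theta01 (expR_gt0 _) theta_gap d_gt0) => M.
  apply: contrapT => h; apply: unb; exists M => n.
  by rewrite leNgt; apply/negP => /ltW hn; apply: h; exists n.
have [m [m01 m0 mrec]] := mag_limit theta01 d_gt0 hM.
exact: (multiple_gibbs Htree Hlocfin Hinf Hth (size_fchildren Hd) m01 m0 mrec).
Qed.

(** The chain with zero field is always a Gibbs state, so uniqueness can fail only through
    multiplicity. *)
Lemma unique_gibbs_iff :
  unique_gibbs_state e o J beta <-> ~ multiple_gibbs_states e o J beta.
Proof.
split=> [[mu gmu uniq_mu] [m1 [m2 [g1 g2 [A mA]]]]|nm].
  by apply; rewrite (uniq_mu m1 g1 A mA) (uniq_mu m2 g2 A mA).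
have [mu gmu _] := free_gibbs_exists o J beta Htree Hlocfin Hinf.
exists mu => // nu gnu A mA; apply: contrapT => neq; apply: nm.
by exists nu, mu; split => //; exists A.
Qed.

End Dichotomy.

Theorem corollary2p3 (R : realType) (V : choiceType) (e : rel V) (o : V)
    (J : V -> R) (Jmin Jmax beta : R)
    (Htree : is_tree e)
    (Hinfinite : infinite_set [set: V])
    (Hlocfin : locally_finite e)
    (Hleaf : forall v : V, is_leaf e v -> v = o)
    (HJmin : 0 < Jmin)
    (HJ : forall v : V, v <> o -> Jmin <= J v <= Jmax)
    (Hbeta : 0 < beta) :
  (forall (theta : nat -> R) (d : nat -> nat),
     (forall v : V, v <> o -> tanh (beta * J v) = theta (dist e o v)) ->
     spherically_symmetric_with e o d ->
     (multiple_gibbs_states e o J beta <->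
      (\sum_(1 <= n <oo)
         (\prod_(1 <= i < n.+1) ((d i)%:R * theta i) ^- 2)%:E < +oo)%E))
  /\
  (forall (theta alpha c1 c2 : R),
     0 < theta < 1 ->
     (forall v : V, v <> o -> tanh (beta * J v) = theta) ->
     spherically_symmetric e o ->
     0 < c1 <= c2 ->
     (forall n : nat, (0 < n)%N ->
        c1 * theta ^- n * n%:R `^ alpha <= (#|` fset_set (level e o n)|)%:R
          <= c2 * theta ^- n * n%:R `^ alpha) ->
     (unique_gibbs_state e o J beta <-> alpha <= 1 / 2)).
Proof.
split=> [theta d Htheta Hd|theta alpha c1 c2 /andP[t0 t1] Htheta [d Hd] /andP[c10 c12] HT].
  rewrite (multiple_gibbs_iff Htree Hinfinite Hlocfin HJmin HJ Hbeta Htheta Hd).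
  symmetry; apply: (nneseries_ltyP (u := level_term theta d)) => n.
  by apply: prodr_ge0 => i _; rewrite invr_ge0 sqr_ge0.
rewrite unique_gibbs_iff//.
rewrite (multiple_gibbs_iff (theta := fun=> theta) Htree Hinfinite Hlocfin HJmin HJ Hbeta _ Hd)//.
(* The level size is the product of the d_i, so the term of the series is comparable to n^(-2
   alpha). *)
have termE n : level_term (fun=> theta) d n =
    ((#|` fset_set (level e o n)|)%:R * theta ^+ n) ^- 2.
  rewrite (size_level Htree Hlocfin Hd) /level_term prodfV prodrXl; congr (_ ^+ 2)^-1.
  by rewrite big_split /= prodr_const_nat subn1 /= natr_prod.
have c20 : 0 < c2 by exact: lt_le_trans c12.
have bnd n : (0 < n)%N -> c1 * n%:R `^ alpha <=
    (#|` fset_set (level e o n)|)%:R * theta ^+ n <= c2 * n%:R `^ alpha.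
  move=> n0; have /andP[h1 h2] := HT n n0.
  have tn0 : 0 < theta ^+ n by rewrite exprn_gt0.
  have E (c : R) : c * theta ^- n * n%:R `^ alpha * theta ^+ n = c * n%:R `^ alpha.
    by field; rewrite gt_eqF.
  by rewrite -(E c1) -(E c2) !(ler_pM2r tn0) h1.
have pw0 n : (0 < n)%N -> 0 < (n%:R : R) `^ alpha by move=> n0; rewrite powR_gt0 ?ltr0n.
have low n : (0 < n)%N -> c2 ^- 2 * (n%:R `^ alpha) ^- 2 <= level_term (fun=> theta) d n.
  move=> n0; have /andP[h1 h2] := bnd n n0; have p0 := pw0 n n0.
  rewrite termE -invfM -exprMn; apply: inv_sqr_le h2.
  by apply: lt_le_trans h1; rewrite mulr_gt0.
have upp n : (0 < n)%N -> level_term (fun=> theta) d n <= c1 ^- 2 * (n%:R `^ alpha) ^- 2.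
  move=> n0; have /andP[h1 h2] := bnd n n0; have p0 := pw0 n n0.
  by rewrite termE -invfM -exprMn; apply: inv_sqr_le h1; rewrite mulr_gt0.
split=> [nb|al [M hM]].
  rewrite leNgt; apply/negP => al; apply: nb.
  have [M hM] := power_sum_bounded al; exists (c1 ^- 2 * M) => n.
  apply: (@le_trans _ _ (\sum_(1 <= j < n.+1) c1 ^- 2 * (j%:R `^ alpha) ^- 2)).
    by rewrite big_nat [leRHS]big_nat; apply: ler_sum => j /andP[j0 _]; exact: upp.
  by rewrite -mulr_sumr ler_wpM2l// invr_ge0 sqr_ge0.
(* The factor c2^2 compensates the constant lost in the lower bound [low]. *)
have [n hn] := power_sum_unbounded (c2 ^+ 2 * M) al.
have := hM n; apply/negP; rewrite -ltNge.
have c22 : 0 < c2 ^+ 2 by rewrite exprn_gt0.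
rewrite -(ltr_pM2l c22); apply: (lt_le_trans hn).
rewrite mulr_sumr big_nat [leRHS]big_nat; apply: ler_sum => j /andP[j0 _].
by rewrite -ler_pdivrMl//; exact: low.
Qed.
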